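(* Let $0<\alpha\le1$, let $\{\mathcal{S}^\alpha(t)\}_{t\ge0}$ be the generalized fractional Skellam process with rates $\lambda_j,\mu_j>0$, $j=1,\dots,k$, let $\{D_f(t)\}_{t\ge0}$ be an independent Lévy subordinator with $\mathbb{E}(D_f^r(t))<\infty$ for all $r>0$, and let $\mathcal{Z}_f^\alpha(t)=\mathcal{S}^\alpha(D_f(t))$. Then the moment generating function $\mathcal{M}_f^\alpha(u,t)=\mathbb{E}(e^{u\mathcal{Z}_f^\alpha(t)})$ is $$\mathcal{M}_f^\alpha(u,t)=\sum_{n=0}^\infty\frac{\Big(\sum_{j=1}^k\big(\lambda_j(e^{uj}-1)+\mu_j(e^{-uj}-1)\big)\Big)^n}{\Gamma(n\alpha+1)}\mathbb{E}\big((D_f(t))^{n\alpha}\big),\qquad u\in\mathbb{R},$$ and for every integer $r\ge1$ the $r$th order moment is $$\mathbb{E}\big((\mathcal{Z}_f^\alpha(t))^r\big)=r!\sum_{n=1}^r\frac{\mathbb{E}\big((D_f(t))^{n\alpha}\big)}{\Gamma(n\alpha+1)}\sum_{m_1+\dots+m_n=r,\ m_i\in\mathbb{N}}\ \prod_{l=1}^n\Big(\frac{1}{m_l!}\sum_{j=1}^k\big(j^{m_l}\lambda_j+(-1)^{m_l}j^{m_l}\mu_j\big)\Big),$$ where $\mathbb{N}=\{1,2,\dots\}$.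
   Context: Fix an integer $k\ge1$ and positive rates $\lambda_1,\dots,\lambda_k,\mu_1,\dots,\mu_k$. The generalized counting process (GCP) with rates $\lambda_1,\dots,\lambda_k$ is a Lévy process started at $0$ performing jumps of size $j\in\{1,\dots,k\}$ at rate $\lambda_j$. The generalized Skellam process (GSP) is $\mathcal{S}(t)=M_1(t)-M_2(t)$, with $M_1,M_2$ independent GCPs with rates $\lambda_j$ and $\mu_j$, respectively. For $0<\alpha<1$, the inverse stable subordinator is $Y_\alpha(t)=\inf\{x\ge0: D_\alpha(x)>t\}$, where $D_\alpha$ is the stable subordinator, $\mathbb{E}(e^{-sD_\alpha(t)})=e^{-ts^\alpha}$. The generalized fractional Skellam process (GFSP) is $\mathcal{S}^\alpha(t)=\mathcal{S}(Y_\alpha(t))$ for $0<\alpha<1$ with $\mathcal{S}$ and $Y_\alpha$ independent, and $\mathcal{S}^1(t)=\mathcal{S}(t)$. A Lévy subordinator $\{D_f(t)\}_{t\ge0}$ is a one-dimensional Lévy process with non-decreasing sample paths, $D_f(0)=0$ a.s., and $\mathbb{E}(e^{-sD_f(t)})=e^{-tf(s)}$, $s>0$, where $f$ is its Bernštein function. The process $\mathcal{Z}_f^\alpha$ is called the time-changed generalized fractional Skellam process-I (TCGFSP-I).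
   Formalization: The moment generating function formula is asserted not for all real u, but for those u where the base of the powers is nonnegative (both sides possibly infinite) or the series converges to a real number; for a negative base the series can diverge (e.g. gamma subordinator, α=1). *)

(* Defs.v *)
From HB Require Import structures.
From mathcomp Require Import all_boot all_order all_algebra.
From mathcomp Require Import all_classical all_reals all_analysis.

Set Implicit Arguments.
Unset Strict Implicit.
Unset Printing Implicit Defensive.

Import Order.TTheory GRing.Theory Num.Theory.
Import numFieldNormedType.Exports.

Local Open Scope classical_set_scope.
Local Open Scope ring_scope.

(* Meaningful for 0 < x. *)
Definition Gamma {R : realType} (x : R) : R :=
  \int[lebesgue_measure]_(s in `]0, +oo[) (s `^ (x - 1) * expR (- s)).

Definition bernstein {R : realType} (f : R -> R) : Prop :=
  [/\ forall s, 0 < s -> 0 <= f s,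
      forall n s, 0 < s -> derivable (derive1n n f) s 1
    & forall n s, 0 < s -> 0 <= (-1) ^+ n * derive1n n.+1 f s].

Definition cadlag {R : realType} (x : R -> R) : Prop :=
  (forall t, 0 <= t -> x s @[s --> t^'+] --> x t) /\
  (forall t, 0 < t -> cvg (x s @[s --> t^'-])).

Section processes.
Context d (Omega : measurableType d) (R : realType) (P : probability Omega R).

(* A process is a family X : R -> Omega -> R; only times t >= 0 are relevant,
   and nothing is ever assumed about X t for t < 0. *)

Definition process_sigma (X : R -> Omega -> R) : set (set Omega) :=
  <<s [set A | exists t (B : set R),
         [/\ 0 <= t, measurable B & A = X t @^-1` B]] >>.

Definition independent_processes (X Y : R -> Omega -> R) : Prop :=
  forall A B, process_sigma X A -> process_sigma Y B ->
    P (A `&` B) = (P A * P B)%E.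

(* Mutual independence of X(t_1) - X(t_0), ..., X(t_n) - X(t_(n-1)); the product
   rule for subfamilies is the case where some of the B_i are setT. *)
Definition independent_increments (X : R -> Omega -> R) : Prop :=
  forall (n : nat) (t : nat -> R) (B : nat -> set R),
    0 <= t 0%N -> (forall i, (i < n)%N -> t i <= t i.+1) ->
    (forall i, measurable (B i)) ->
    P (\bigcap_(i in [set i | (i < n)%N])
         [set w | B i (X (t i.+1) w - X (t i) w)]) =
    (\prod_(i < n) P [set w | B i (X (t i.+1) w - X (t i) w)%R])%E.

Definition stationary_increments (X : R -> Omega -> R) : Prop :=
  forall (s h : R) (B : set R), 0 <= s -> 0 <= h -> measurable B ->
    P [set w | B (X (s + h) w - X s w)] = P [set w | B (X h w)].

(* Stochastic continuity follows from these clauses. *)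
Definition levy_process (X : R -> Omega -> R) : Prop :=
  [/\ forall t, 0 <= t -> measurable_fun setT (X t),
      {ae P, forall w, X 0 w = 0},
      independent_increments X,
      stationary_increments X
    & forall w, cadlag (X ^~ w)].

(* Lévy process with P(M(h) = j) = lam_j h + o(h) for 1 <= j <= k and
   P(M(h) = 0) = 1 - (lam_1 + ... + lam_k) h + o(h) as h -> 0+; hence also
   P(M(h) \notin {0, ..., k}) = o(h).  The rate lam_j is lam i with j = i.+1. *)
Definition gcp (k : nat) (lam : 'I_k -> R) (M : R -> Omega -> R) : Prop :=
  [/\ levy_process M,
      forall i : 'I_k,
        fine (P [set w | M h w = i.+1%:R]) / h @[h --> 0^'+] --> lam i
    & (1 - fine (P [set w | M h w = 0])) / h @[h --> 0^'+] -->
        \sum_(i < k) lam i].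

Definition gsp (k : nat) (lam mu : 'I_k -> R) (S : R -> Omega -> R) : Prop :=
  exists M1 M2 : R -> Omega -> R,
    [/\ gcp lam M1, gcp mu M2, independent_processes M1 M2
      & forall t w, 0 <= t -> S t w = M1 t w - M2 t w].

(* Nonnegativity is required surely, since D t w is used as a random time. *)
Definition levy_subordinator (f : R -> R) (D : R -> Omega -> R) : Prop :=
  [/\ levy_process D,
      forall w t, 0 <= t -> 0 <= D t w,
      forall w s t, 0 <= s -> s <= t -> D s w <= D t w,
      bernstein f
    & forall s t, 0 < s -> 0 <= t ->
        'E_P[fun w => expR (- (s * D t w))%R]%E = (expR (- (t * f s)))%:E].

Definition stable_subordinator (alpha : R) (D : R -> Omega -> R) : Prop :=
  levy_subordinator (fun s => s `^ alpha) D.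

(* The set is nonempty almost surely; otherwise the infimum is 0 by convention. *)
Definition inverse_process (D : R -> Omega -> R) : R -> Omega -> R :=
  fun t w => inf [set x : R | 0 <= x /\ t < D x w].

Definition gfsp (alpha : R) (k : nat) (lam mu : 'I_k -> R)
    (X : R -> Omega -> R) : Prop :=
  exists2 S : R -> Omega -> R, gsp lam mu S &
    (alpha = 1 /\ forall t w, 0 <= t -> X t w = S t w) \/
    (0 < alpha < 1 /\
     exists D : R -> Omega -> R,
       [/\ stable_subordinator alpha D,
           independent_processes S (inverse_process D)
         & forall t w, 0 <= t -> X t w = S (inverse_process D t w) w]).

End processes.

Definition skellam_exponent {R : realType} (k : nat) (lam mu : 'I_k -> R)
    (u : R) : R :=
  \sum_(i < k) (lam i * (expR (u * i.+1%:R) - 1) +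
                mu i * (expR (- (u * i.+1%:R)) - 1)).

(* Main.v *)
(* For a counting process M, independence of the increments over the grid i t / n
   gives E(e^(u M(t)); all increments in {0, ..., k}) =
   (sum_j e^(u j) P(M(t / n) = j))^n, and n -> oo yields E e^(u M(t)); truncation
   removes the event because its probability tends to 1.  Hence
   E e^(u S(t)) = e^(t psi(u)) for the Skellam process, and comparing Taylor
   polynomials in u gives E S(t)^r as a polynomial in t.

   An independent random time Y is approximated from the right by discrete times,
   so right continuity gives E phi(S(Y)) = E G(Y) with G(q) = E phi(S(q)).  This is
   used twice: with the inverse stable subordinator and then with D_f.

   For the inverse Y(t) of the stable subordinator D,
   E Y(t)^n = int_0^oo n x^(n-1) P(D(x) <= t) dx has Laplace transform
   n! s^(-n alpha - 1) in t; being monotone in t it equals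
   n! t^(n alpha) / Gamma(n alpha + 1).

   When psi(u) < 0, the alternating Taylor bounds of e^(psi(u) y), integrated
   against the laws of Y(t) and D_f(t), squeeze the moment generating function
   between consecutive partial sums of the series. *)

Require Import Defs.
From HB Require Import structures.
From mathcomp Require Import all_boot all_order all_algebra.
From mathcomp Require Import all_classical all_reals all_analysis.
From mathcomp Require Import measurable_realfun ring lra.
Import Order.TTheory GRing.Theory Num.Theory.
Import numFieldNormedType.Exports.
Local Open Scope classical_set_scope.
Local Open Scope ring_scope.

Set Implicit Arguments.
Unset Strict Implicit.
Unset Printing Implicit Defensive.

(** * Integration preliminaries *)

(** A [gcp] is specified only by the behaviour of its law near time [0], so the law of [M t] is
    never written down; moment generating functions carry the information, and moments are read off
    without differentiating under an integral. No process is assumed jointly measurable; right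
    continuity has to supply this. Since the time change is iterated, the composite of the Skellam
    process with the inverse subordinator must be right continuous as well, although the inverse may
    fall back to the default [0] of [inf] where its defining set becomes empty. Laplace transforms
    are compared only at positive integers. This makes the integrals of a weighted difference vanish
    on intervals; monotonicity of one function and continuity of the other then turn this into
    equality at every point. The sign of the exponent separates two regimes. When it is nonnegative,
    every interchange of sum and integral is monotone and both sides may be [+oo]. When it is
    negative, the series of absolute values may diverge, so no interchange is available: convergence
    of the signed series is an input, and the bounds only identify its limit. *)

Lemma ge0_fubini_on {R : realType} d1 d2 (T1 : measurableType d1)
    (T2 : measurableType d2) (m1 : {sigma_finite_measure set T1 -> \bar R})
    (m2 : {sigma_finite_measure set T2 -> \bar R}) (D1 : set T1) (D2 : set T2)
    (f : T1 * T2 -> \bar R) :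
  measurable D1 -> measurable D2 -> measurable_fun [set: T1 * T2] f ->
  (forall z, 0 <= f z)%E ->
  (\int[m1]_(x in D1) \int[m2]_(y in D2) f (x, y) =
   \int[m2]_(y in D2) \int[m1]_(x in D1) f (x, y))%E.
Proof.
move=> mD1 mD2 mf f0.
pose g := f \_ (D1 `*` D2).
have g0 z : (0 <= g z)%E by rewrite /g /patch; case: ifP.
have mg : measurable_fun setT g.
  apply/(measurable_restrictT f (measurableX mD1 mD2)).
  exact: measurable_funTS.
have gE x y : g (x, y) = if (x \in D1) && (y \in D2) then f (x, y) else 0%E.
  by rewrite /g /patch in_setX.
rewrite integral_mkcond [RHS]integral_mkcond.
transitivity (\int[m1]_x \int[m2]_y g (x, y))%E.
  apply: eq_integral => x _; rewrite patchE; case: ifPn => xD.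
    by rewrite integral_mkcond; apply: eq_integral => y _; rewrite gE patchE xD.
  by rewrite integral0_eq// => y _; rewrite gE (negbTE xD).
rewrite fubini_tonelli//; apply: eq_integral => y _; rewrite patchE.
case: ifPn => yD.
  rewrite [RHS]integral_mkcond; apply: eq_integral => x _.
  by rewrite gE patchE yD andbT.
by rewrite integral0_eq// => x _; rewrite gE (negbTE yD) andbF.
Qed.

Lemma integral_min_cvg {R : realType} d (T : measurableType d)
    (mu : {measure set T -> \bar R}) (V : T -> R) :
  measurable_fun setT V -> (forall x, 0 <= V x) ->
  (\int[mu]_x (Num.min (V x) n%:R)%:E @[n --> \oo] --> \int[mu]_x (V x)%:E)%E.
Proof.
move=> mV V0.
have H : (fun x => limn (fun n : nat => (Num.min (V x) n%:R)%:E)) =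
         (fun x => (V x)%:E).
  apply/funext => x; apply/cvg_lim => //; apply: cvg_near_cst.
  near=> n; rewrite min_l//.
  near: n; exists (Num.truncn (V x)).+1 => // n /= xn.
  by rewrite ltW// -truncn_lt_nat.
rewrite -H; apply: cvg_monotone_convergence => //.
- by move=> n; apply/measurable_EFinP; exact: measurable_minr.
- by move=> n x _; rewrite lee_fin le_min V0 ler0n.
- move=> x _ m n mn; rewrite lee_fin le_min ge_min lexx/= ge_min.
  by rewrite ler_nat mn orbT.
Unshelve. all: by end_near. Qed.

(** The [A n] are not assumed nested, so monotone convergence does not apply to them. For the upper
    bound, cut [V] at [K]: [min V K] is at most [V] on [A n] and at most [K] off it, so its integral
    is bounded by the integral over [A n] plus [K * (1 - P (A n))]. Letting [n], then [K], tend to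
    infinity gives [v]. *)
Lemma ge0_integral_limit_events {R : realType} d (T : measurableType d)
    (P : probability T R) (V : T -> R) (A : nat -> set T) (v : R) :
  measurable_fun setT V -> (forall x, 0 <= V x) ->
  (forall n, measurable (A n)) ->
  P (A n) @[n --> \oo] --> 1%E ->
  (\int[P]_(x in A n) (V x)%:E @[n --> \oo] --> v%:E)%E ->
  (\int[P]_x (V x)%:E = v%:E)%E.
Proof.
move=> mV V0 mA PA1 intA.
apply/eqP; rewrite eq_le; apply/andP; split; last first.
  apply: (cvge_to_le intA); apply: nearW => n.
  apply: ge0_subset_integral => //; first exact/measurable_EFinP.
  by move=> x _; rewrite lee_fin.

apply: (cvge_to_le (integral_min_cvg (mu := P) mV V0)); apply: nearW => K.
have mmin : measurable_fun setT (fun x => Num.min (V x) K%:R).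
  exact: measurable_minr.
have min0 x : (0 <= (Num.min (V x) K%:R)%:E)%E.
  by rewrite lee_fin le_min V0 ler0n.
have cv : (\int[P]_(x in A n) (V x)%:E + K%:R%:E * (1 - P (A n)) @[n --> \oo]
    --> v%:E)%E.
  rewrite -[X in _ --> X]adde0; apply: cvgeD => //.
  rewrite -(mule0 K%:R%:E); apply: cvgeZl => //.
  rewrite -(subee (x := 1%:E))//; apply: cvgeB => //; exact: cvg_cst.
apply: (cvge_to_ge cv); apply: nearW => n.
rewrite -(setUv (A n)) ge0_integral_setU//=; last 3 first.
- exact: measurableC.
- by rewrite setUv; exact/measurable_EFinP.
- by rewrite disj_set2E setICr.
apply: leeD.
  apply: ge0_le_integral => //.
  - by apply: measurable_funTS; exact/measurable_EFinP.
  - by apply: measurable_funTS; exact/measurable_EFinP.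
  - by move=> x _; rewrite lee_fin ge_min lexx.
rewrite -probability_setC// -integral_cst//; last exact: measurableC.
apply: ge0_le_integral => //.
- exact: measurableC.
- by apply: measurable_funTS; exact/measurable_EFinP.
- by move=> x _; rewrite lee_fin ge_min lexx orbT.
Qed.

(** * Expectations at an independent random time *)

Definition indep_rv {R : realType} d (T : measurableType d)
    (P : probability T R) (U V : T -> R) : Prop :=
  forall B C : set R, measurable B -> measurable C ->
    P (U @^-1` B `&` V @^-1` C) = (P (U @^-1` B) * P (V @^-1` C))%E.

(** Independence says that the joint law of [(U, V)] agrees with the product of the two laws on
    rectangles, hence everywhere; Tonelli then separates the factors. Values in [[0, +oo]] avoid any
    integrability condition. *)
Lemma ge0_integral_indep_prod {R : realType} d (T : measurableType d)
    (P : probability T R) (U V : T -> R) (f g : R -> \bar R) :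
  measurable_fun setT U -> measurable_fun setT V -> indep_rv P U V ->
  measurable_fun setT f -> measurable_fun setT g ->
  (forall x, 0 <= f x)%E -> (forall x, 0 <= g x)%E ->
  (\int[P]_x (f (U x) * g (V x)) =
   \int[P]_x f (U x) * \int[P]_x g (V x))%E.
Proof.
move=> mU mV UV mf mg f0 g0.
pose X : {RV P >-> R} := HB.pack U (isMeasurableFun.Build _ _ _ _ _ mU).
pose Y : {RV P >-> R} := HB.pack V (isMeasurableFun.Build _ _ _ _ _ mV).
have mW : measurable_fun setT (fun x => (U x, V x)) by exact: measurable_fun_pair.
have mfg : measurable_fun [set: R * R] (fun z => f z.1 * g z.2)%E.
  by apply: emeasurable_funM; exact: measurableT_comp.
transitivity (\int[pushforward P (fun x => (U x, V x))]_z (f z.1 * g z.2))%E.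
  by rewrite ge0_integral_pushforward//= => z _; exact: mule_ge0.
transitivity (\int[distribution P X \x distribution P Y]_z (f z.1 * g z.2))%E.
  apply: eq_measure_integral => A mA _;exact/esym/product_measure_unique.
rewrite fubini_tonelli1//; last by move=> z; exact: mule_ge0.
under eq_integral => x _ do rewrite /fubini_F/= ge0_integralZl//.
rewrite ge0_integralZr//; last exact: integral_ge0.
by rewrite !ge0_integral_pushforward.
Qed.

Lemma integral_preimage_indep {R : realType} d (T : measurableType d)
    (P : probability T R) (U V : T -> R) (f : R -> \bar R) (C : set R) :
  measurable_fun setT U -> measurable_fun setT V -> indep_rv P U V ->
  measurable_fun setT f -> (forall x, 0 <= f x)%E -> measurable C ->
  (\int[P]_(x in V @^-1` C) f (U x) =
   \int[P]_x f (U x) * P (V @^-1` C))%E.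
Proof.
move=> mU mV UV mf f0 mC.
have mVC : measurable (V @^-1` C) by rewrite -[X in measurable X]setTI; exact: mV.
transitivity (\int[P]_x (f (U x) * (\1_C (V x))%:E))%E.
  rewrite integral_mkcond; apply: eq_integral => x _.
  rewrite patchE indicE.
  have -> : (x \in V @^-1` C) = (V x \in C) by apply/idP/idP; rewrite !inE.
  by case: ifP => _; rewrite ?mule1 ?mule0.
rewrite (ge0_integral_indep_prod (g := fun y => (\1_C y)%:E) mU mV UV mf)//.
  by congr (_ * _)%E; have := integral_indic P measurableT mVC; rewrite setIT.
exact/measurable_EFinP.
Qed.

(* Approximating the random time from the right keeps the value of a
   right-continuous process in the limit. *)
Definition upper_time {R : realType} (n : nat) (x : R) : R :=
  (Num.truncn (n.+1%:R * x)).+1%:R / n.+1%:R.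

Lemma upper_time_gt {R : realType} n (x : R) : x < upper_time n x.
Proof. by rewrite /upper_time ltr_pdivlMr// mulrC truncnS_gt. Qed.

Lemma upper_time_le {R : realType} n (x : R) : 0 <= x ->
  upper_time n x <= x + n.+1%:R^-1.
Proof.
move=> x0; rewrite /upper_time ler_pdivrMr// mulrDl mulVf// mulrC -natr1 lerD2r.
by rewrite mulrC truncn_le mulr_ge0.
Qed.

(** The strict inequality [upper_time_gt] keeps the sequence inside punctured right neighbourhoods,
    so any right limit can be composed with it. *)
Lemma upper_time_cvg {R : realType} (x : R) : 0 <= x ->
  upper_time n x @[n --> \oo] --> x^'+.
Proof.
move=> x0 A [e /= e0 Ae].
have /cvgr_dist_lt/(_ _ e0) := @cvg_harmonic R.
apply: filter_app; near=> n; rewrite /= sub0r normrN => nE.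
apply: Ae; last exact: upper_time_gt.
rewrite /= ltr0_norm ?subr_lt0 ?upper_time_gt// opprB.
rewrite ltrBlDl (le_lt_trans (upper_time_le _ x0))// ltrD2l.
by apply: le_lt_trans nE; rewrite /= ger0_norm.
Unshelve. all: by end_near. Qed.

Lemma measurable_truncn_eq {R : realType} d (T : measurableType d)
    (U : T -> R) (n j : nat) : measurable_fun setT U -> (forall x, 0 <= U x) ->
  measurable [set x | Num.truncn (n.+1%:R * U x) = j].
Proof.
move=> mU U0.
have -> : [set x | Num.truncn (n.+1%:R * U x) = j] =
    U @^-1` `[j%:R / n.+1%:R, j.+1%:R / n.+1%:R[%classic.
  apply/seteqP; split => x /=; rewrite in_itv/= ler_pdivrMr// ltr_pdivlMr//;
    rewrite (mulrC (U x)).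
    by move=> <-; rewrite truncn_itv// mulr_ge0.
  exact: truncn_def.
by rewrite -[X in measurable X]setTI; exact: mU.
Qed.

(** On each level set of the truncation the discretised time is a constant, so measurability at
    fixed times is enough. *)
Lemma measurable_upper_time {R : realType} d d' (T : measurableType d)
    (T' : measurableType d')
    (X : R -> T -> T') (U : T -> R) (n : nat) :
  (forall t, 0 <= t -> measurable_fun setT (X t)) ->
  measurable_fun setT U -> (forall x, 0 <= U x) ->
  measurable_fun setT (fun x => X (upper_time n (U x)) x).
Proof.
move=> mX mU U0.
pose F j := [set x | Num.truncn (n.+1%:R * U x) = j].
have -> : [set: T] = \bigcup_j F j by apply/seteqP; split => x // _; exists (Num.truncn (n.+1%:R * U x)).
apply/measurable_fun_bigcup => [j|j]; first exact: measurable_truncn_eq.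
apply: (eq_measurable_fun (X (j.+1%:R / n.+1%:R))).
  by move=> x; rewrite inE /F/= /upper_time => ->.
by apply: measurable_funTS; exact: mX.
Qed.

Lemma measurable_time_change {R : realType} d (T : measurableType d)
    (X : R -> T -> R) (U : T -> R) :
  (forall t, 0 <= t -> measurable_fun setT (X t)) ->
  (forall x t, 0 <= t -> X s x @[s --> t^'+] --> X t x) ->
  measurable_fun setT U -> (forall x, 0 <= U x) ->
  measurable_fun setT (fun x => X (U x) x).
Proof.
move=> mX cX mU U0.
apply: (@measurable_fun_cvg _ _ _ _ (fun n x => X (upper_time n (U x)) x)).
  by move=> n; exact: measurable_upper_time.
move=> x _; apply: (@cvg_comp _ _ _ (upper_time^~ (U x)) (X ^~ x) \oo _ _ _ (cX x _ (U0 x))).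
exact: upper_time_cvg.
Qed.

Section time_change.
Context {R : realType} d (T : measurableType d) (P : probability T R).
Variables (X : R -> T -> R) (U : T -> R).
Hypothesis mX : forall t : R, 0 <= t -> measurable_fun setT (X t).
Hypothesis cX : forall x (t : R), 0 <= t -> X s x @[s --> t^'+] --> X t x.
Hypothesis mU : measurable_fun setT U.
Hypothesis U0 : forall x, 0 <= U x.
Hypothesis XU : forall t : R, 0 <= t -> indep_rv P (X t) U.

(** Cut the space into the countably many pieces on which the discretised time is constant. Each
    piece is an event on [U], independent of [X] at that constant time, so the integral over it
    factors. *)
Lemma integral_upper_time (phi : R -> R) (n : nat) :
  measurable_fun setT phi -> (forall x, 0 <= phi x) ->
  (\int[P]_x (phi (X (upper_time n (U x)) x))%:E =
   \int[P]_x (\int[P]_y (phi (X (upper_time n (U x)) y))%:E))%E.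
Proof.
move=> mphi phi0.
pose F j := [set x | Num.truncn (n.+1%:R * U x) = j].
have mF j : measurable (F j) by exact: measurable_truncn_eq.
have UF : [set: T] = \bigcup_j F j.
  by apply/seteqP; split => x // _; exists (Num.truncn (n.+1%:R * U x)).
have tF : trivIset setT F.
  by move=> i j _ _ [x [/= <- <-]].
have q0 j : 0 <= j.+1%:R / n.+1%:R :> R by rewrite divr_ge0.
have qE j x : F j x -> upper_time n (U x) = j.+1%:R / n.+1%:R.
  by rewrite /F/= /upper_time => ->.
have m1 : measurable_fun setT (fun x => phi (X (upper_time n (U x)) x)).
  by apply: measurableT_comp => //; exact: measurable_upper_time.
pose G q := (\int[P]_y (phi (X q y))%:E)%E.
have G0 q : (0 <= G q)%E by apply: integral_ge0 => y _; rewrite lee_fin.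
(* Viewed as a process that does not depend on the sample point, [G] is measurable at each fixed
   time; no regularity in [q] is involved. *)
have m2 : measurable_fun setT (fun x => G (upper_time n (U x))).
  by apply: (measurable_upper_time (X := fun q _ => G q)) => // t t0.
change (\int[P]_x (phi (X (upper_time n (U x)) x))%:E =
  \int[P]_x G (upper_time n (U x)))%E.
rewrite UF ge0_integral_bigcup//; last first.
- by move=> x _; rewrite lee_fin.
- by rewrite -[Z in measurable_fun Z _]UF; apply/measurable_EFinP; exact: m1.
rewrite [RHS]ge0_integral_bigcup//; last first.
  by rewrite -[Z in measurable_fun Z _]UF; exact: m2.
apply: eq_eseriesr => j _.
transitivity (\int[P]_(x in F j) (EFin \o phi) (X (j.+1%:R / n.+1%:R) x))%E.
  by apply: eq_integral => x; rewrite inE => /qE <-.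
have FE : F j = U @^-1` `[j%:R / n.+1%:R, j.+1%:R / n.+1%:R[%classic.
  apply/seteqP; split => x /=; rewrite in_itv/= ler_pdivrMr// ltr_pdivlMr//;
    rewrite (mulrC (U x)).
    by move=> <-; rewrite truncn_itv// mulr_ge0.
  exact: truncn_def.
rewrite {1}FE integral_preimage_indep//; [|exact: mX|exact: XU|]; last first.
  exact/measurable_EFinP.
rewrite -FE -(integral_cst P (mF j)); apply: eq_integral => x.
by rewrite inE => /qE ->.
Qed.

Let G (phi : R -> R) q := (\int[P]_y (phi (X q y))%:E)%E.

(** The bound [K] dominates everything, so dominated convergence passes to the limit in both sides
    of [integral_upper_time]. It also shows that [G phi] is continuous along the discretised times,
    which is where the measurability of [G phi] composed with [U] comes from. *)
Lemma bounded_integral_time_change (phi : R -> R) (K : R) :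
  continuous phi -> (forall x, 0 <= phi x <= K) ->
  measurable_fun setT (fun x => G phi (U x)) /\
  (\int[P]_x (phi (X (U x) x))%:E = \int[P]_x (G phi (U x)))%E.
Proof.
move=> cphi phiK.
have phi0 x : 0 <= phi x by have /andP[] := phiK x.
have phile x : phi x <= K by have /andP[] := phiK x.
have mphi : measurable_fun setT phi by exact: continuous_measurable_fun.
have K0 : 0 <= K by exact: le_trans (phile 0).
have iK : P.-integrable setT (fun=> K%:E) by exact: finite_measure_integrable_cst.
have G0 q : (0 <= G phi q)%E by apply: integral_ge0 => y _; rewrite lee_fin.
have GK (q : R) : 0 <= q -> (G phi q <= K%:E)%E.
  move=> q0; apply: (@le_trans _ _ (\int[P]_y (cst K%:E y))%E).
    apply: ge0_le_integral => //.
    - by move=> y _; rewrite lee_fin.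
    - by apply/measurable_EFinP; apply: measurableT_comp => //; exact: mX.
    - by move=> y _; rewrite lee_fin.
  rewrite integral_cst//.
  by apply: (le_trans (lee_wpmul2l _ (probability_le1 P measurableT))); rewrite ?mule1.
have up0 n (x : R) : 0 <= x -> 0 <= upper_time n x.
  by move=> x0; rewrite (le_trans x0)// ltW// upper_time_gt.
have cphiX x (q : R) : 0 <= q -> (phi (X (upper_time n q) x))%:E @[n --> \oo] --> (phi (X q x))%:E.
  move=> q0; apply/cvg_EFin; first exact: nearW.
  have c1 : X (upper_time n q) x @[n --> \oo] --> X q x.
    apply: (@cvg_comp _ _ _ (upper_time^~ q) (X ^~ x) \oo _ _ _ (@cX x q q0)).
    exact: upper_time_cvg.
  exact: (@cvg_comp _ _ _ _ phi \oo _ _ c1 (cphi _)).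
have cG (q : R) : 0 <= q -> G phi (upper_time n q) @[n --> \oo] --> G phi q.
  move=> q0.
  have [] // := @dominated_convergence _ _ _ P _ measurableT
    (fun n y => (phi (X (upper_time n q) y))%:E) (fun y => (phi (X q y))%:E)
    (fun=> K%:E).
  - move=> n; apply/measurable_EFinP; apply: measurableT_comp => //.
    by apply: mX; exact: up0.
  - by apply/measurable_EFinP; apply: measurableT_comp => //; exact: mX.
  - by apply: aeW => y _; exact: cphiX.
  - by apply: aeW => y n _; rewrite lee_fin ger0_norm.
have mGn n : measurable_fun setT (fun x => G phi (upper_time n (U x))).
  exact: (measurable_upper_time (X := fun q _ => G phi q)).
have mGU : measurable_fun setT (fun x => G phi (U x)).
  apply: (emeasurable_fun_cvg (fun n x => G phi (upper_time n (U x)))) => //.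
  by move=> x _; exact: cG.
split => //.
have [] // := @dominated_convergence _ _ _ P _ measurableT
    (fun n x => (phi (X (upper_time n (U x)) x))%:E) (fun x => (phi (X (U x) x))%:E)
    (fun=> K%:E).
- move=> n; apply/measurable_EFinP; apply: measurableT_comp => //.
  exact: measurable_upper_time.
- apply/measurable_EFinP; apply: measurableT_comp => //.
  exact: measurable_time_change.
- by apply: aeW => y _; exact: cphiX.
- by apply: aeW => y n _; rewrite lee_fin ger0_norm.
move=> _ _ c1.
have [] // := @dominated_convergence _ _ _ P _ measurableT
    (fun n x => G phi (upper_time n (U x))) (fun x => G phi (U x))
    (fun=> K%:E).
- by apply: aeW => y _; exact: cG.
- by apply: aeW => y n _; rewrite gee0_abs// GK// up0.
move=> _ _ c2.
have c12 : (fun n => \int[P]_x (phi (X (upper_time n (U x)) x))%:E)%E =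
  (fun n => \int[P]_x (G phi (upper_time n (U x))))%E.
  by apply/funext => n; exact: integral_upper_time.
by rewrite c12 in c1; exact: cvg_unique c1 c2.
Qed.

(** Apply the bounded case to [min phi n] and let [n] grow: monotone convergence is used on the
    left, inside [G], and on the outer integral of [G]. *)
Lemma ge0_integral_time_change (phi : R -> R) :
  continuous phi -> (forall x, 0 <= phi x) ->
  measurable_fun setT (fun x => G phi (U x)) /\
  (\int[P]_x (phi (X (U x) x))%:E = \int[P]_x (G phi (U x)))%E.
Proof.
move=> cphi phi0.
have mphi : measurable_fun setT phi by exact: continuous_measurable_fun.
pose psi n x := Num.min (phi x) n%:R : R.
have cpsi n : continuous (psi n).
  by move=> x; apply: (@continuous_min _ _ phi (cst n%:R)); [exact: cphi|exact: cst_continuous].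
have psiK n x : 0 <= psi n x <= n%:R.
  by rewrite /psi le_min phi0 ler0n ge_min lexx orbT.
have H n := bounded_integral_time_change (cpsi n) (psiK n).
have cG (q : R) : 0 <= q -> G (psi n) q @[n --> \oo] --> G phi q.
  move=> q0; apply: (integral_min_cvg (mu := P) (V := fun y => phi (X q y))) => //.
  by apply: measurableT_comp => //; exact: mX.
have mG : measurable_fun setT (fun x => G phi (U x)).
  apply: (emeasurable_fun_cvg (fun n x => G (psi n) (U x))).
    by move=> n; have [] := H n.
  by move=> x _; exact: cG.
split => //.
have c1 : (\int[P]_x (psi n (X (U x) x))%:E @[n --> \oo] -->
    \int[P]_x (phi (X (U x) x))%:E)%E.
  apply: (integral_min_cvg (mu := P) (V := fun y => phi (X (U y) y))) => //.
  by apply: measurableT_comp => //; exact: measurable_time_change.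
have c2 : (\int[P]_x (G (psi n) (U x)) @[n --> \oo] -->
    \int[P]_x (G phi (U x)))%E.
  have <- : (fun x => limn (fun n => G (psi n) (U x))) = (fun x => G phi (U x)).
    by apply/funext => x; apply/cvg_lim => //; exact: cG.
  apply: cvg_monotone_convergence => //.
  - by move=> n; have [] := H n.
  - move=> n x _; apply: integral_ge0 => y _; rewrite lee_fin.
    by have /andP[] := psiK n (X (U x) y).
  - move=> x _ m n mn; apply: ge0_le_integral => //.
    + by move=> y _; rewrite lee_fin; have /andP[] := psiK m (X (U x) y).
    + apply/measurable_EFinP; apply: (measurableT_comp (f := psi m)).
        exact: continuous_measurable_fun.
      exact: mX.
    + apply/measurable_EFinP; apply: (measurableT_comp (f := psi n)).
        exact: continuous_measurable_fun.
      exact: mX.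
    + move=> y _; rewrite lee_fin le_min ge_min lexx/= ge_min.
      by rewrite ler_nat mn orbT.
have c12 : (fun n => \int[P]_x (psi n (X (U x) x))%:E)%E =
  (fun n => \int[P]_x (G (psi n) (U x)))%E.
  by apply/funext => n; have [] := H n.
by rewrite c12 in c1; exact: cvg_unique c1 c2.
Qed.

End time_change.

(** The nonnegative case applies to the positive and negative parts of [phi] separately. The bound
    [h] makes both resulting integrals finite, so that their difference is legitimate. *)
Lemma signed_integral_time_change {R : realType} d (T : measurableType d)
    (P : probability T R) (X : R -> T -> R) (U : T -> R) (phi g h : R -> R) :
  (forall t : R, 0 <= t -> measurable_fun setT (X t)) ->
  (forall x (t : R), 0 <= t -> X s x @[s --> t^'+] --> X t x) ->
  measurable_fun setT U -> (forall x, 0 <= U x) ->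
  (forall t : R, 0 <= t -> indep_rv P (X t) U) ->
  continuous phi ->
  (forall q : R, 0 <= q -> (\int[P]_x (phi (X q x))%:E = (g q)%:E)%E) ->
  (forall q : R, 0 <= q -> (\int[P]_x `|phi (X q x)|%:E <= (h q)%:E)%E) ->
  P.-integrable setT (fun x => (h (U x))%:E) ->
  (\int[P]_x (phi (X (U x) x))%:E = \int[P]_x (g (U x))%:E)%E.
Proof.
move=> mX cX mU U0 XU cphi gE hE ih.
have mphi : measurable_fun setT phi by exact: continuous_measurable_fun.
pose pos y := Num.max (phi y) 0; pose neg y := Num.max (- phi y) 0.
have cpos : continuous pos.
  by move=> x; apply: (@continuous_max _ _ phi (cst 0)); [exact: cphi|exact: cst_continuous].
have cneg : continuous neg.
  move=> x; apply: (@continuous_max _ _ (fun y => - phi y) (cst 0)); last exact: cst_continuous.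
  exact/continuousN/cphi.
have pos0 y : 0 <= pos y by rewrite le_max lexx orbT.
have neg0 y : 0 <= neg y by rewrite le_max lexx orbT.
pose Gp (q : R) := (\int[P]_x (pos (X q x))%:E)%E.
pose Gn (q : R) := (\int[P]_x (neg (X q x))%:E)%E.
have [mGp Ep] := ge0_integral_time_change mX cX mU U0 XU cpos pos0.
have [mGn En] := ge0_integral_time_change mX cX mU U0 XU cneg neg0.
have decomp (V : T -> R) : (\int[P]_x (phi (V x))%:E =
    \int[P]_x (pos (V x))%:E - \int[P]_x (neg (V x))%:E)%E.
  rewrite integralE; congr (_ - _)%E; apply: eq_integral => x _.
    by rewrite funeposE/= EFin_max.
  by rewrite funenegE/= EFin_max.
have bound (psi : R -> R) (q : R) : (forall y, 0 <= psi y <= `|phi y|) -> continuous psi -> 0 <= q ->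
    (0%E <= \int[P]_x (psi (X q x))%:E <= (h q)%:E)%E.
  move=> psib cpsi q0; apply/andP; split.
    by apply: integral_ge0 => x _; rewrite lee_fin; have /andP[] := psib (X q x).
  apply: le_trans (hE _ q0); apply: ge0_le_integral => //.
  - by move=> x _; rewrite lee_fin; have /andP[] := psib (X q x).
  - apply/measurable_EFinP; apply: (measurableT_comp (f := psi)).
      exact: continuous_measurable_fun.
    exact: mX.
  - apply/measurable_EFinP; apply: measurableT_comp => //.
    by apply: measurableT_comp => //; exact: mX.
  - by move=> x _; rewrite lee_fin; have /andP[] := psib (X q x).
have posb y : 0 <= pos y <= `|phi y| by rewrite pos0 /pos ge_max ler_norm normr_ge0.
have negb y : 0 <= neg y <= `|phi y|.
  by rewrite neg0 /neg ge_max normr_ge0 -normrN ler_norm.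
have Gpb (q : R) : 0 <= q -> (0 <= Gp q <= (h q)%:E)%E by exact: bound.
have Gnb (q : R) : 0 <= q -> (0 <= Gn q <= (h q)%:E)%E by exact: bound.
have igen (G : R -> \bar R) : (forall q : R, 0 <= q -> (0 <= G q <= (h q)%:E)%E) ->
    measurable_fun setT (fun x => G (U x)) -> P.-integrable setT (fun x => G (U x)).
  move=> Gb mG; apply: le_integrable ih => // x _.
  have /andP[h1 h2] := Gb _ (U0 x).
  by rewrite gee0_abs// gee0_abs// (le_trans h1).
rewrite decomp Ep En -integralB//; [|exact: (igen Gp)|exact: (igen Gn)].
apply: eq_integral => x _.
by rewrite -gE// decomp.
Qed.

Lemma moments_time_change {R : realType} d (T : measurableType d)
    (P : probability T R) (X : R -> T -> R) (U : T -> R) (g : nat -> R -> R) :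
  (forall t : R, 0 <= t -> measurable_fun setT (X t)) ->
  (forall x (t : R), 0 <= t -> X s x @[s --> t^'+] --> X t x) ->
  measurable_fun setT U -> (forall x, 0 <= U x) ->
  (forall t : R, 0 <= t -> indep_rv P (X t) U) ->
  (forall r (q : R), (0 < r)%N -> 0 <= q ->
    (\int[P]_x (X q x ^+ r)%:E = (g r q)%:E)%E) ->
  (forall r, (0 < r)%N -> P.-integrable setT (fun x => (g r (U x))%:E)) ->
  forall r, (0 < r)%N ->
    (\int[P]_x (X (U x) x ^+ r)%:E = \int[P]_x (g r (U x))%:E)%E.
Proof.
move=> mX cX mU U0 XU gE ig r r0.
have r20 : (0 < r + r)%N by rewrite addn_gt0 r0.
(* The dominating function comes from [|a| <= 1 + a^2] with [a = x^r]: absolute moments of order [r]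
   are controlled by the even moment of order [r + r], whose value [g] is known. *)
apply: (signed_integral_time_change (phi := fun x => x ^+ r)
  (h := fun q => 1 + g (r + r)%N q)) => //.
- by move=> x; exact: exprn_continuous.
- by move=> q q0; exact: gE.
- move=> q q0.
  rewrite EFinD -gE// -[X in (_ <= X + _)%E](_ : \int[P]_x (cst 1%E x) = 1)%E; last first.
    rewrite integral_cst// mul1e; exact: probability_setT.
  have mXr n : measurable_fun setT (fun x => (X q x ^+ n)%:E).
    by apply/measurable_EFinP; apply: measurable_funX; exact: mX.
  have ev x : 0 <= X q x ^+ (r + r) by rewrite exprD -expr2 sqr_ge0.
  rewrite -ge0_integralD//.
  apply: ge0_le_integral => //.
  + apply/measurable_EFinP; apply: measurableT_comp => //.
    by apply: measurable_funX; exact: mX.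
  + exact: emeasurable_funD.
  + move=> x _; rewrite lee_fin exprD.
    set a := X q x ^+ r; have := sqr_ge0 (`|a| - 1).
    have -> : a * a = `|a| ^+ 2 by rewrite real_normK ?num_real// expr2.
    by have := normr_ge0 a; nra.
  by move=> x _; rewrite lee_fin.
- apply: (@eq_integrable _ _ _ P _ measurableT (fun x => 1%:E + (g (r + r)%N (U x))%:E)%E) => //.
  apply: integrableD => //; last exact: ig.
  exact: finite_measure_integrable_cst.
Qed.

(** * The moment generating function of the counting process *)

(** With [y = x n / n.+1], one has [exp (y / (1 + y)) <= 1 + y <= exp y]. The left bound is
    [1 + z <= exp z] at [z = - y / (1 + y)], after taking inverses. Raising to the power [n.+1]
    squeezes the sequence between two exponentials with the same limit. *)
Lemma cvg_exp_sequence {R : realType} (x : nat -> R) (l : R) :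
  x n @[n --> \oo] --> l ->
  (1 + x n / n.+1%:R) ^+ n.+1 @[n --> \oo] --> expR l.
Proof.
move=> xl.
have y0 : x n / n.+1%:R @[n --> \oo] --> (0 : R).
  by rewrite -[X in _ --> X](mulr0 l); apply: cvgM => //; exact: cvg_harmonic.
have y1 : 1 + x n / n.+1%:R @[n --> \oo] --> (1 : R).
  by rewrite -[X in _ --> X]addr0; apply: cvgD => //; exact: cvg_cst.
have ub : expR (x n) @[n --> \oo] --> expR l.
  by apply: continuous_cvg => //; exact: continuous_expR.
have lb : expR (x n / (1 + x n / n.+1%:R)) @[n --> \oo] --> expR l.
  apply: continuous_cvg; first exact: continuous_expR.
  rewrite -[X in _ --> X]divr1; apply: cvgM => //.
  by apply: cvgV => //; rewrite oner_eq0.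
apply: squeeze_cvgr lb ub; near=> n.
have p0 : 0 < 1 + x n / n.+1%:R.
  near: n; apply: (cvgr_gt _ y1); exact: ltr01.
set y := x n / n.+1%:R in p0 *.
have xE : x n = y *+ n.+1 by rewrite -mulr_natr /y divfK.
rewrite xE mulrnAl -[y *+ _]mulr_natl -[(y / _) *+ _]mulr_natl !expRM_natl; apply/andP; split.
  apply: lerXn2r; rewrite ?nnegrE ?expR_ge0 ?(ltW p0)//.
  rewrite -[X in X <= _]invrK -expRN -[X in _ <= X]invrK lef_pV2 ?posrE ?expR_gt0 ?invr_gt0//.
  apply: le_trans (expR_ge1Dx _); rewrite -mulNr.
  rewrite -[X in _ <= X + _](divff (lt0r_neq0 p0)) -mulrDl addrK mul1r.
  exact: lexx.
by apply: lerXn2r; rewrite ?nnegrE ?expR_ge0 ?(ltW p0) ?expR_ge1Dx.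
Unshelve. all: by end_near. Qed.

Section gcp_mgf.
Context {R : realType} d (T : measurableType d) (P : probability T R).
Variables (k : nat) (lam : 'I_k -> R) (M : R -> T -> R).
Hypothesis gM : gcp P lam M.

Let mM (t : R) : 0 <= t -> measurable_fun setT (M t).
Proof. by case: gM => -[+ _ _ _ _] _ _; exact. Qed.

Definition jump_prob (h : R) (j : 'I_k.+1) : R :=
  fine (P [set w | M h w = j%:R]).

Lemma measurable_level_set (V : T -> R) (a : R) : measurable_fun setT V ->
  measurable [set w | V w = a].
Proof.
by move=> mV; have := mV measurableT _ (measurable_set1 a); rewrite setTI.
Qed.

Lemma jump_probE (h : R) (j : 'I_k.+1) : 0 <= h ->
  P [set w | M h w = j%:R] = (jump_prob h j)%:E.
Proof.
move=> h0; rewrite /jump_prob fineK//; apply: fin_num_measure.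
by apply: measurable_level_set; exact: mM.
Qed.

Definition gcp_exponent (u : R) : R :=
  \sum_(i < k) lam i * (expR (u * i.+1%:R) - 1).

(** The base is [1 + t * gcp_exponent u / n.+1] up to [o(1 / n)]: the term [j = 0] contributes minus
    the total rate, each [j >= 1] contributes its rate times [exp (u j)]. *)
Lemma jump_prob_sum_cvg (t u : R) : 0 < t ->
  (\sum_(j < k.+1) expR (u * j%:R) * jump_prob (t / n.+1%:R) j) ^+ n.+1
    @[n --> \oo] --> expR (t * gcp_exponent u).
Proof.
move=> t0.
pose s n := \sum_(j < k.+1) expR (u * j%:R) * jump_prob (t / n.+1%:R) j.
pose h (n : nat) := t / n.+1%:R.
have h0 n : 0 < h n by rewrite divr_gt0.
have h00 : h n @[n --> \oo] --> (0 : R).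
  rewrite -[X in _ --> X](mulr0 t); apply: cvgM; first exact: cvg_cst.
  exact: cvg_harmonic.
have hcv : h n @[n --> \oo] --> (0 : R)^'+.
  move=> A [e /= e0 Ae]; have /cvgr_dist_lt/(_ _ e0) := h00.
  by apply: filter_app; near=> n => nE; apply: Ae.
case: gM => _ H1 H0.
have c0 : (1 - jump_prob (h n) ord0) / h n @[n --> \oo] --> \sum_(i < k) lam i.
  apply: (@cvg_comp _ _ _ h (fun x => (1 - fine (P [set w | M x w = 0])) / x) \oo _ _ hcv).
  exact: H0.
have c1 (i : 'I_k) : jump_prob (h n) (lift ord0 i) / h n @[n --> \oo] --> lam i.
  apply: (@cvg_comp _ _ _ h (fun x => fine (P [set w | M x w = i.+1%:R]) / x) \oo _ _ hcv).
  exact: H1.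
have cs : n.+1%:R * (s n - 1) @[n --> \oo] --> t * gcp_exponent u.
  have -> : (fun n => n.+1%:R * (s n - 1)) = (fun n => t *
    (\sum_(i < k) expR (u * i.+1%:R) * (jump_prob (h n) (lift ord0 i) / h n) -
     (1 - jump_prob (h n) ord0) / h n)).
    apply/funext => n; rewrite /s big_ord_recl mulr0 expR0 mul1r -/(h n).
    under [in RHS]eq_bigr do rewrite mulrA.
    rewrite -mulr_suml -mulrBl /h.
    under [in LHS]eq_bigr do rewrite /= /bump/= add1n.
    field.
    by rewrite (lt0r_neq0 t0) /= ?natr1 ?nat1r pnatr_eq0.
  have -> : gcp_exponent u =
    \sum_(i < k) expR (u * i.+1%:R) * lam i - \sum_(i < k) lam i.
    rewrite -sumrB; apply: eq_bigr => i _; by rewrite mulrBr mulr1 mulrC.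
  apply: cvgM; first exact: cvg_cst.
  apply: cvgB => //; apply: cvg_big => [|i _]; first exact: add_continuous.
  by apply: cvgM => //; exact: cvg_cst.
apply: cvg_trans (cvg_exp_sequence cs); apply: near_eq_cvg; near=> n.
by congr (_ ^+ _); rewrite [_ * (s n - 1)]mulrC mulfK ?pnatr_eq0// addrC subrK.
Unshelve. all: by end_near. Qed.

(* All n+1 increments over a regular grid take values in {0, ..., k}: the event
   has probability tending to 1, and on it the counting process is a sum of
   independent bounded variables. *)
Section grid.
Variables (t : R) (n : nat).
Hypothesis t0 : 0 < t.

Let tau (i : nat) := i%:R * (t / n.+1%:R).

(** [f] prescribes the increment over each grid step. The intersection runs over natural numbers to
    match [independent_increments]; [inord] is faithful because only indices below [n.+1] occur. *)
Definition grid_event (f : {ffun 'I_n.+1 -> 'I_k.+1}) : set T :=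
  \bigcap_(i in [set i | (i < n.+1)%N])
    [set w | M (tau i.+1) w - M (tau i) w = (f (inord i))%:R].

Let tau0 i : 0 <= tau i.
Proof. by rewrite mulr_ge0// divr_ge0// ltW. Qed.

Let tauS i : tau i.+1 = tau i + t / n.+1%:R.
Proof. by rewrite /tau -natr1 mulrDl mul1r. Qed.

Lemma measurable_grid_event f : measurable (grid_event f).
Proof.
apply: bigcap_measurable => [|i _]; first by exists 0%N.
apply: measurable_level_set.
by apply: measurable_funB; exact: mM.
Qed.

Lemma grid_event_prob f :
  P (grid_event f) = (\prod_(i < n.+1) jump_prob (t / n.+1%:R) (f i))%:E.
Proof.
case: gM => -[_ _ ind stat _] _ _.
have := ind n.+1 tau (fun i => [set (f (inord i))%:R]) (tau0 0).
rewrite /grid_event => ->; last 2 first.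
- by move=> i _; rewrite tauS lerDl divr_ge0// ltW.
- by move=> i; exact: measurable_set1.
rewrite -prodEFin; apply: eq_bigr => i _.
rewrite -jump_probE ?divr_ge0 ?(ltW t0)// inord_val tauS.
have := stat (tau i) (t / n.+1%:R) _ (tau0 i) _ (measurable_set1 (f i)%:R); apply.
by rewrite divr_ge0// ltW.
Qed.

Lemma grid_event_trivIset : trivIset setT grid_event.
Proof.
move=> f g _ _ [w [fw gw]]; apply/ffunP => i.
have := fw i (ltn_ord i); have /= -> := gw i (ltn_ord i).
by rewrite inord_val => /eqP; rewrite eqr_nat => /eqP /val_inj ->.
Qed.

Lemma grid_event_sum f w : grid_event f w -> M 0 w = 0 ->
  M t w = \sum_(i < n.+1) (f i)%:R.
Proof.
move=> fw M0.
transitivity (\sum_(0 <= i < n.+1) (M (tau i.+1) w - M (tau i) w)).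
  by rewrite telescope_sumr// {2}/tau mul0r M0 subr0 /tau mulrC divfK.
rewrite big_mkord; apply: eq_bigr => i _.
by have := fw i (ltn_ord i); rewrite /= inord_val.
Qed.

Definition grid_cover : set T :=
  \big[setU/set0]_(f : {ffun 'I_n.+1 -> 'I_k.+1}) grid_event f.

(** On each grid event [M t] is almost surely the constant sum of the values of [f], so the integral
    is a product over the grid steps. Summing over all [f] expands the power of a sum by
    distributivity. *)
Lemma integral_grid_cover (u : R) :
  (\int[P]_(w in grid_cover) (expR (u * M t w))%:E =
   ((\sum_(j < k.+1) expR (u * j%:R) * jump_prob (t / n.+1%:R) j) ^+ n.+1)%:E)%E.
Proof.
have mexp : measurable_fun setT (fun w => (expR (u * M t w))%:E).
  apply/measurable_EFinP; apply: measurableT_comp => //.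
  by apply: measurable_funM => //; apply: mM; exact: ltW.
rewrite ge0_integral_bigsetU//; last first.
- exact: measurable_funTS.
- by apply: sub_trivIset grid_event_trivIset.
- exact: index_enum_uniq.
- exact: measurable_grid_event.
have M0 : {ae P, forall w, M 0 w = 0} by case: gM => -[].
transitivity (\sum_(f : {ffun 'I_n.+1 -> 'I_k.+1}) (\prod_(i < n.+1)
    (expR (u * (f i)%:R) * jump_prob (t / n.+1%:R) (f i)))%:E)%E; last first.
  rewrite sumEFin; congr EFin; rewrite -(bigA_distr_bigA (fun (i : 'I_n.+1) (j : 'I_k.+1) =>
    expR (u * j%:R) * jump_prob (t / n.+1%:R) j)) /=.
  by rewrite prodr_const card_ord.
apply: eq_bigr => f _.
transitivity (\int[P]_(w in grid_event f)
    (cst (expR (u * \sum_(i < n.+1) (f i)%:R))%:E w))%E.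
  apply: ae_eq_integral => //.
  - exact: measurable_grid_event.
  - exact: measurable_funTS.
  - by apply: filterS M0 => w M0 fw; rewrite (grid_event_sum fw M0).
rewrite integral_cst; last exact: measurable_grid_event.
rewrite [X in (_ * X)%E](grid_event_prob f) -EFinM; congr EFin.
by rewrite big_split/= mulr_sumr expR_sum.
Qed.

End grid.

Lemma measurable_grid_cover t n : 0 < t -> measurable (grid_cover t n).
Proof.
move=> t0; rewrite /grid_cover; apply: bigsetU_measurable => f _.
exact: measurable_grid_event.
Qed.

Lemma gcp_mgf (t u : R) : 0 <= t ->
  (\int[P]_w (expR (u * M t w))%:E = (expR (t * gcp_exponent u))%:E)%E.
Proof.
rewrite le_eqVlt => /predU1P[<-|t0].
  rewrite mul0r expR0 -(probability_setT P) -[RHS]mul1e -integral_cst//.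
  apply: ae_eq_integral => //.
    apply/measurable_EFinP; apply: measurableT_comp => //.
    by apply: measurable_funM => //; exact: mM.
  have : {ae P, forall w, M 0 w = 0} by case: gM => -[].
  by apply: filterS => w M0 _; rewrite M0 mulr0 expR0.
apply: (ge0_integral_limit_events (A := grid_cover t)).
- apply: measurableT_comp => //.
  by apply: measurable_funM => //; apply: mM; exact: ltW.
- by move=> w; exact: expR_ge0.
- by move=> n; exact: measurable_grid_cover.
(* The probability of the cover is the case [u = 0] of the same formula, and its limit is
   [exp 0 = 1] because the exponent vanishes at [0]. *)
- have -> : (fun n => P (grid_cover t n)) =
    (fun n => \int[P]_(w in grid_cover t n) (expR (0 * M t w))%:E)%E.
    apply/funext => n; under eq_integral do rewrite mul0r expR0.
    by rewrite integral_cst ?mul1e//; exact: measurable_grid_cover.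
  have e0 : expR (t * gcp_exponent 0) = 1.
    rewrite /gcp_exponent big1 ?mulr0 ?expR0// => i _.
    by rewrite mul0r expR0 subrr mulr0.
  under eq_fun do rewrite integral_grid_cover//.
  apply/fine_cvgP; split; first exact: nearW.
  have c := jump_prob_sum_cvg (u := 0) t0; rewrite e0 in c; exact: c.
- under eq_fun do rewrite integral_grid_cover//.
  apply/fine_cvgP; split; first exact: nearW.
  exact: (jump_prob_sum_cvg (u := u) t0).
Qed.

End gcp_mgf.

(** * The Skellam process at a fixed time *)

Section gsp.
Context {R : realType} d (T : measurableType d) (P : probability T R).
Variables (k : nat) (lam mu : 'I_k -> R) (S : R -> T -> R).
Hypothesis gS : gsp P lam mu S.

Lemma gsp_measurable (t : R) : 0 <= t -> measurable_fun setT (S t).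
Proof.
move=> t0; case: gS => M1 [M2 [[[m1 _ _ _ _] _ _] [[m2 _ _ _ _] _ _] _ SE]].
apply: (eq_measurable_fun (fun w => M1 t w - M2 t w)).
  by move=> w _; rewrite SE.
by apply: measurable_funB; [exact: m1|exact: m2].
Qed.

Lemma gsp_right_continuous (w : T) (t : R) : 0 <= t ->
  S s w @[s --> t^'+] --> S t w.
Proof.
move=> t0; case: gS => M1 [M2 [[[_ _ _ _ c1] _ _] [[_ _ _ _ c2] _ _] _ SE]].
rewrite SE//; have [r1 _] := c1 w; have [r2 _] := c2 w.
apply: cvg_trans (cvgB (r1 _ t0) (r2 _ t0)); apply: near_eq_cvg.
near=> s; rewrite SE//.
by apply: (le_trans t0); apply: ltW; near: s; exact: nbhs_right_gt.
Unshelve. all: by end_near. Qed.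

Lemma process_sigma_preimage (X : R -> T -> R) (t : R) (B : set R) :
  0 <= t -> measurable B -> process_sigma X (X t @^-1` B).
Proof. by move=> t0 mB; apply: sub_gen_smallest; exists t, B. Qed.

Lemma skellam_exponentE (u : R) :
  skellam_exponent lam mu u = gcp_exponent lam u + gcp_exponent mu (- u).
Proof.
rewrite /skellam_exponent /gcp_exponent -big_split/=; apply: eq_bigr => i _.
by rewrite mulNr.
Qed.

Lemma gsp_mgf (t u : R) : 0 <= t ->
  (\int[P]_w (expR (u * S t w))%:E = (expR (t * skellam_exponent lam mu u))%:E)%E.
Proof.
move=> t0; case: gS => M1 [M2 [g1 g2 ind SE]].
have mE (v : R) : measurable_fun setT (fun x : R => (expR (v * x))%:E).
  by apply/measurable_EFinP; apply: measurableT_comp => //; exact: measurable_funM.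
rewrite skellam_exponentE mulrDr expRD EFinM.
rewrite -(gcp_mgf g1 u t0) -(gcp_mgf g2 (- u) t0).
rewrite -(@ge0_integral_indep_prod _ _ _ _ (M1 t) (M2 t)
  (fun x => (expR (u * x))%:E) (fun x => (expR (- u * x))%:E)) //.
- by apply: eq_integral => w _; rewrite SE// -EFinM -expRD mulrBr mulNr.
- by case: g1 => -[+ _ _ _ _] _ _; exact.
- by case: g2 => -[+ _ _ _ _] _ _; exact.
- by move=> B C mB mC; apply: ind; exact: process_sigma_preimage.
Qed.

End gsp.

(** In the tail, take out [|x|^n] and use [i! <= (i + n)!]. With [x = u V] this crude form isolates
    the factor [u^n] and leaves a quantity free of [u] once [|u| <= 1]. *)
Lemma expR_taylor_bound {R : realType} (x : R) (n : nat) :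
  `|expR x - \sum_(i < n) x ^+ i / i`!%:R| <= `|x| ^+ n * expR `|x|.
Proof.
have cv (y : R) : (\sum_(0 <= i < N) y ^+ i / i`!%:R) @[N --> \oo] --> expR y.
  exact: is_cvg_series_exp_coeff.
have c1 : `|(\sum_(0 <= i < N) x ^+ i / i`!%:R) - \sum_(i < n) x ^+ i / i`!%:R|
    @[N --> \oo] --> `|expR x - \sum_(i < n) x ^+ i / i`!%:R|.
  by apply: cvg_norm; apply: cvgB; [exact: cv|exact: cvg_cst].
have c2 : `|x| ^+ n * (\sum_(0 <= i < N) `|x| ^+ i / i`!%:R)
    @[N --> \oo] --> `|x| ^+ n * expR `|x|.
  by apply: cvgM; [exact: cvg_cst|exact: cv].
apply: (ler_cvg_to c1 c2); near=> N.
have nN : (n <= N)%N by near: N; exists n.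
rewrite -(big_mkord xpredT (fun i => x ^+ i / i`!%:R)) (big_cat_nat (n := n) (p := N))//= addrAC subrr add0r.
apply: le_trans (ler_norm_sum _ _ _) _.
rewrite -{1}[n]add0n big_addn.
apply: (@le_trans _ _ (\sum_(0 <= i < N - n) `|x| ^+ n * (`|x| ^+ i / i`!%:R))).
  apply: ler_sum => i _.
  rewrite normrM normrX exprD (mulrC (`|x| ^+ i)) -mulrA ler_wpM2l ?exprn_ge0//.
  rewrite ler_wpM2l ?exprn_ge0// normfV ger0_norm// lef_pV2 ?posrE ?ltr0n ?fact_gt0//.
  by rewrite ler_nat leq_fact ?leq_addr.
rewrite -mulr_sumr ler_wpM2l ?exprn_ge0//.
rewrite [X in _ <= X](big_cat_nat (n := N - n))//= ?leq_subr// lerDl.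
by apply: sumr_ge0 => i _; rewrite divr_ge0// exprn_ge0.
Unshelve. all: by end_near. Qed.

(** * Moments from the moment generating function *)

(* Equality up to O(u ^ r) on ]0, 1]; the bound on f and g themselves makes the
   relation stable under products. *)
Definition eq_upto {R : realType} (r : nat) (f g : R -> R) : Prop :=
  exists2 C : R, 0 <= C & forall u, 0 < u -> u <= 1 ->
    [/\ `|f u| <= C, `|g u| <= C & `|f u - g u| <= C * u ^+ r].

Section eq_upto_theory.
Context {R : realType}.
Implicit Types (f g h : R -> R) (r : nat).

Lemma eq_upto_sym r f g : eq_upto r f g -> eq_upto r g f.
Proof.
move=> [C C0 H]; exists C => // u u0 u1; have [a b c] := H u u0 u1.
by split=> //; rewrite distrC.
Qed.

Lemma eq_upto_trans r f g h : eq_upto r f g -> eq_upto r g h -> eq_upto r f h.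
Proof.
move=> [C C0 H] [D D0 K]; exists (C + D); first exact: addr_ge0.
move=> u u0 u1; have [a1 b1 c1] := H u u0 u1; have [a2 b2 c2] := K u u0 u1.
split; [by lra|by lra|].
have -> : f u - h u = (f u - g u) + (g u - h u) by ring.
by rewrite mulrDl (le_trans (ler_normD _ _))// lerD.
Qed.

Lemma eq_upto_ext r f g f' g' : f =1 f' -> g =1 g' ->
  eq_upto r f g -> eq_upto r f' g'.
Proof.
move=> ff gg [C C0 H]; exists C => // u u0 u1.
by rewrite -ff -gg; exact: H.
Qed.

Lemma eq_upto_cst r (c : R) : eq_upto r (fun=> c) (fun=> c).
Proof.
exists `|c| => // u u0 u1; split => //.
by rewrite subrr normr0 mulr_ge0// exprn_ge0// ltW.
Qed.

Lemma eq_uptoD r f g f' g' : eq_upto r f g -> eq_upto r f' g' ->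
  eq_upto r (fun u => f u + f' u) (fun u => g u + g' u).
Proof.
move=> [C C0 H] [D D0 K]; exists (C + D); first exact: addr_ge0.
move=> u u0 u1; have [a1 b1 c1] := H u u0 u1; have [a2 b2 c2] := K u u0 u1.
split; [by rewrite (le_trans (ler_normD _ _))// lerD..|].
have -> : f u + f' u - (g u + g' u) = (f u - g u) + (f' u - g' u) by ring.
by rewrite mulrDl (le_trans (ler_normD _ _))// lerD.
Qed.

Lemma eq_uptoM r f g f' g' : eq_upto r f g -> eq_upto r f' g' ->
  eq_upto r (fun u => f u * f' u) (fun u => g u * g' u).
Proof.
move=> [C C0 H] [D D0 K]; exists (C * D + C * D).
  by rewrite addr_ge0// mulr_ge0.
move=> u u0 u1; have [a1 b1 c1] := H u u0 u1; have [a2 b2 c2] := K u u0 u1.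
have CD : C * D <= C * D + C * D by rewrite lerDl mulr_ge0.
have ur : 0 <= u ^+ r by rewrite exprn_ge0// ltW.
split.
- by rewrite normrM (le_trans _ CD)// ler_pM.
- by rewrite normrM (le_trans _ CD)// ler_pM.
have -> : f u * f' u - g u * g' u = (f u - g u) * f' u + g u * (f' u - g' u) by ring.
rewrite (le_trans (ler_normD _ _))// [X in _ <= X]mulrDl lerD// normrM.
  by rewrite mulrAC ler_pM.
by rewrite -mulrA ler_pM.
Qed.

Lemma eq_uptoX r f g n : eq_upto r f g ->
  eq_upto r (fun u => f u ^+ n) (fun u => g u ^+ n).
Proof.
move=> fg; elim: n => [|n IH].
  by apply: eq_upto_ext (eq_upto_cst r 1) => u; rewrite expr0.
by apply: eq_upto_ext (eq_uptoM fg IH) => u; rewrite exprS.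
Qed.

Lemma eq_upto_sum r (I : Type) (s : seq I) (Q : pred I) (F G : I -> R -> R) :
  (forall i, Q i -> eq_upto r (F i) (G i)) ->
  eq_upto r (fun u => \sum_(i <- s | Q i) F i u) (fun u => \sum_(i <- s | Q i) G i u).
Proof.
move=> H; elim: s => [|a s IH].
  by apply: eq_upto_ext (eq_upto_cst r 0) => u; rewrite big_nil.
case Qa: (Q a).
  by apply: eq_upto_ext (eq_uptoD (H _ Qa) IH) => u; rewrite big_cons Qa.
by apply: eq_upto_ext IH => u; rewrite big_cons Qa.
Qed.

Lemma eq_upto_id r : eq_upto r (@id R) id.
Proof.
exists 1 => // u u0 u1; rewrite gtr0_norm//; split => //.
by rewrite subrr normr0 mul1r exprn_ge0// ltW.
Qed.

Lemma eq_upto_poly_refl r (p : {poly R}) : eq_upto r (fun u => p.[u]) (fun u => p.[u]).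
Proof.
apply: (@eq_upto_ext _ (fun u => \sum_(i < size p) p`_i * u ^+ i)
  (fun u => \sum_(i < size p) p`_i * u ^+ i)).
- by move=> u; rewrite horner_coef.
- by move=> u; rewrite horner_coef.
apply: eq_upto_sum => i _; apply: eq_uptoM; first exact: eq_upto_cst.
by apply: eq_uptoX; exact: eq_upto_id.
Qed.

(** Letting [u] tend to [0] kills the constant term; then [p] is divisible by [X], and dividing the
    bound by [u] lowers the order by one for the induction. *)
Lemma eq_upto_poly0 r (p : {poly R}) : eq_upto r (fun u => p.[u]) (fun=> 0) ->
  forall i, (i < r)%N -> p`_i = 0.
Proof.
elim: r p => // r IH p pr.
have [C C0 H] := pr.
have [B B0 K] := eq_upto_poly_refl 0 (drop_poly 1 p).
have pE u : p.[u] = p`_0 + (drop_poly 1 p).[u] * u.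
  rewrite -[in LHS](poly_take_drop 1 p) hornerD hornerM expr1 hornerX; congr (_ + _).
  have -> : take_poly 1 p = (p`_0)%:P.
    by apply/polyP => i; rewrite coef_take_poly coefC; case: i.
  by rewrite hornerC.
have p0 : p`_0 = 0.
  apply/eqP; rewrite -normr_le0; apply/ler_addgt0Pl => e e0; rewrite addr0.
  (* Since [|p_0| <= C u^(r+1) + B u <= (C + B) u], this [u] makes the right side at most [e]; the
     summand [1] keeps the denominator positive. *)
  pose u := Num.min 1 (e / (C + B + 1)).
  have CB : 0 < C + B + 1 by rewrite ltr_wpDl// addr_ge0.
  have u0 : 0 < u by rewrite lt_min ltr01 divr_gt0.
  have u1 : u <= 1 by rewrite ge_min lexx.
  have ue : u * (C + B + 1) <= e by rewrite -ler_pdivlMr// ge_min lexx orbT.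
  have [_ _] := H u u0 u1; have [b _ _] := K u u0 u1.
  rewrite subr0 pE => h.
  have -> : p`_0 = (p`_0 + (drop_poly 1 p).[u] * u) - (drop_poly 1 p).[u] * u by ring.
  rewrite (le_trans (ler_normB _ _))// (le_trans _ ue)//.
  rewrite !mulrDr mulr1 -addrA lerD//.
    rewrite (le_trans h)// exprS mulrCA ler_wpM2l ?(ltW u0)//.
    by rewrite ler_piMr// exprn_ile1// ltW.
  rewrite normrM (gtr0_norm u0) mulrC.
  by rewrite (@le_trans _ _ (u * B)) ?ler_wpM2l ?lerDl ?(ltW u0).
case=> [_//|i]; rewrite ltnS => ir.
have := IH (drop_poly 1 p) _ i ir; rewrite coef_drop_poly addn1; apply.
exists (B + C); first exact: addr_ge0.
move=> u u0 u1; have [_ _] := H u u0 u1; have [b _ _] := K u u0 u1.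
rewrite !subr0 pE p0 add0r normrM (gtr0_norm u0) exprSr mulrA ler_pM2r// => h.
split.
- by rewrite (le_trans b)// lerDl.
- by rewrite normr0 addr_ge0.
by rewrite (le_trans h)// ler_wpM2r ?exprn_ge0 ?(ltW u0)// lerDr.
Qed.

Lemma eq_upto_poly r (p q : {poly R}) :
  eq_upto r (fun u => p.[u]) (fun u => q.[u]) ->
  forall i, (i < r)%N -> p`_i = q`_i.
Proof.
move=> pq i ir; apply/eqP; rewrite -subr_eq0 -coefB; apply/eqP.
apply: (eq_upto_poly0 (r := r)) => //.
have h : eq_upto r (fun u => - q.[u]) (fun u => - q.[u]).
  by apply: eq_upto_ext (eq_upto_poly_refl r (- q)) => u; rewrite hornerN.
by apply: eq_upto_ext (eq_uptoD pq h) => u; rewrite ?hornerD ?hornerN ?subrr.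
Qed.

(** As [f = O(u)], the Taylor remainder [|f|^r exp |f|] is [O(u^r)], with constant [C^r exp C] on
    []0, 1]]. *)
Lemma eq_upto_expR r f (C : R) : 0 <= C ->
  (forall u, 0 < u -> u <= 1 -> `|f u| <= C * u) ->
  eq_upto r (fun u => expR (f u)) (fun u => \sum_(i < r) f u ^+ i / i`!%:R).
Proof.
move=> C0 H.
have e0 : 0 <= expR C by exact: expR_ge0.
have eC u : 0 < u -> u <= 1 -> `|f u| <= C.
  by move=> u0 u1; rewrite (le_trans (H _ u0 u1))// ler_piMr.
exists (2 * expR C + C ^+ r * expR C).
  by rewrite addr_ge0 ?mulr_ge0 ?exprn_ge0.
move=> u u0 u1.
have tb : `|expR (f u) - \sum_(i < r) f u ^+ i / i`!%:R| <= C ^+ r * expR C * u ^+ r.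
  apply: (le_trans (expR_taylor_bound _ _)).
  rewrite mulrAC -exprMn ler_pM ?exprn_ge0 ?expR_ge0//.
    by apply: lerXn2r; rewrite ?nnegrE ?mulr_ge0 ?H// ltW.
  by rewrite ler_expR eC.
have eu : expR (f u) <= expR C by rewrite ler_expR (le_trans (ler_norm _))// eC.
have ur : u ^+ r <= 1 by rewrite exprn_ile1// ltW.
have Cr : 0 <= C ^+ r * expR C by rewrite mulr_ge0 ?exprn_ge0.
have ur0 : 0 <= u ^+ r by rewrite exprn_ge0// ltW.
split.
- by rewrite ger0_norm ?expR_ge0//; lra.
- set s := \sum_(i < r) _ in tb *.
  have -> : s = expR (f u) - (expR (f u) - s) by ring.
  rewrite (le_trans (ler_normB _ _))// ger0_norm ?expR_ge0// lerD//; first by lra.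
  by rewrite (le_trans tb)// ler_piMr//.
- by rewrite (le_trans tb)// ler_wpM2r// lerDr mulr_ge0.
Qed.

End eq_upto_theory.

Section moments_of_mgf.
Context {R : realType} d (T : measurableType d) (P : probability T R).
Variables (V : T -> R) (F : R -> R).
Hypothesis mV : measurable_fun setT V.
Hypothesis mgfV : forall u, (\int[P]_w (expR (u * V w))%:E = (F u)%:E)%E.

(** From [|V|^n <= n! exp |V|] the integrand is at most [n! exp (2 |V|)], hence at most
    [n! (exp (2 V) + exp (- 2 V))], and both exponentials have finite integral. *)
Lemma mgf_integrable n :
  P.-integrable setT (fun w => (`|V w| ^+ n * expR `|V w|)%:E).
Proof.
have iE u : P.-integrable setT (fun w => (expR (u * V w))%:E).
  apply/integrableP; split.
    apply/measurable_EFinP; apply: measurableT_comp => //.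
    exact: measurable_funM.
  under eq_integral do rewrite gee0_abs ?lee_fin ?expR_ge0//.
  by rewrite mgfV ltry.
have iS : P.-integrable setT (fun w => (n`!%:R)%:E * ((expR (2 * V w))%:E + (expR (- 2 * V w))%:E))%E.
  by apply: integrableZl => //; apply: integrableD => //; exact: iE.
apply: le_integrable iS => //.
  apply/measurable_EFinP; apply: measurable_funM.
    by apply: measurable_funX; exact: measurableT_comp.
  by apply: measurableT_comp => //; exact: measurableT_comp.
move=> w _; rewrite -EFinD -EFinM !gee0_abs ?lee_fin ?mulr_ge0 ?exprn_ge0 ?addr_ge0 ?expR_ge0//.
have h1 : `|V w| ^+ n <= n`!%:R * expR `|V w|.
  case: n => [|n]; first by rewrite expr0 mul1r -expR0 ler_expR.
  rewrite mulrC -ler_pdivrMr ?ltr0n ?fact_gt0//.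
  by apply: le_trans (expR_ge1Dxn n (normr_ge0 (V w))); rewrite lerDr.
apply: (@le_trans _ _ (n`!%:R * expR `|V w| * expR `|V w|)).
  by rewrite ler_wpM2r ?expR_ge0.
rewrite -mulrA ler_wpM2l// -expRD.
have -> : `|V w| + `|V w| = 2 * `|V w| by ring.
case: (ger0P (V w)) => _; first by rewrite lerDl expR_ge0.
by rewrite mulrN mulNr lerDr expR_ge0.
Qed.

Lemma mgf_integrable_moment n : P.-integrable setT (fun w => (V w ^+ n)%:E).
Proof.
apply: le_integrable (mgf_integrable n) => //.
  by apply/measurable_EFinP; exact: measurable_funX.
move=> w _; rewrite !abse_EFin lee_fin normrX [X in _ <= X]ger0_norm ?mulr_ge0 ?exprn_ge0 ?expR_ge0//.
rewrite ler_peMr ?exprn_ge0// -expR0 ler_expR//.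
Qed.

(** Integrate [expR_taylor_bound] at [x = u V]. For [0 < u <= 1] the remainder is at most
    [u^r |V|^r exp |V|], whose integral [K] does not depend on [u]. *)
Lemma mgf_eq_upto r :
  eq_upto r F (fun u => (\poly_(i < r) (fine (\int[P]_w (V w ^+ i)%:E)%E / i`!%:R)).[u]).
Proof.
set p := \poly_(i < r) _.
have [C C0 H] := eq_upto_poly_refl r p.
pose K := fine (\int[P]_w (`|V w| ^+ r * expR `|V w|)%:E)%E.
have Kfin := integrable_fin_num measurableT (mgf_integrable r).
have K0 : 0 <= K.
  apply: fine_ge0; apply: integral_ge0 => w _.
  by rewrite lee_fin mulr_ge0// ?exprn_ge0 ?expR_ge0.
exists (C + K); first exact: addr_ge0.
move=> u u0 u1; have [b _ _] := H u u0 u1.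
have E1 : `|F u - p.[u]| <= K * u ^+ r.
  have pE : (\int[P]_w (\sum_(i < r) (u ^+ i / i`!%:R)%:E * (V w ^+ i)%:E) = (p.[u])%:E)%E.
    rewrite integral_sum//; last first.
      by move=> i; apply: integrableZl => //; exact: mgf_integrable_moment.
    rewrite horner_poly -sumEFin; apply: eq_bigr => i _.
    rewrite integralZl//; last exact: mgf_integrable_moment.
    rewrite -[in LHS](fineK (integrable_fin_num measurableT (mgf_integrable_moment i))).
    by rewrite -EFinM; congr EFin; ring.
  have iexp : P.-integrable setT (fun w => (expR (u * V w))%:E).
    apply/integrableP; split.
      apply/measurable_EFinP; apply: measurableT_comp => //.
      exact: measurable_funM.
    under eq_integral do rewrite gee0_abs ?lee_fin ?expR_ge0//.
    by rewrite mgfV ltry.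
  have isum : P.-integrable setT
      (fun w => \sum_(i < r) (u ^+ i / i`!%:R)%:E * (V w ^+ i)%:E)%E.
    apply: integrable_sum => // i _; apply: integrableZl => //.
    exact: mgf_integrable_moment.
  rewrite -lee_fin -abse_EFin EFinB -mgfV -pE -integralB//.
  apply: le_trans (le_abse_integral _ _ _) _ => //.
    by apply: emeasurable_funB; [have /integrableP[] := iexp|have /integrableP[] := isum].
  rewrite EFinM muleC /K fineK// -integralZl//; last exact: mgf_integrable.
  apply: ge0_le_integral => //.
  - apply: measurableT_comp => //.
    by apply: emeasurable_funB; [have /integrableP[] := iexp|have /integrableP[] := isum].
  - by apply: measurable_funeM; have /integrableP[] := mgf_integrable r.
  - move=> w _.
    under eq_bigr do rewrite -EFinM.
    rewrite sumEFin -EFinB abse_EFin -EFinM lee_fin.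
    have -> : \sum_(i < r) u ^+ i / i`!%:R * V w ^+ i =
        \sum_(i < r) (u * V w) ^+ i / i`!%:R.
      by apply: eq_bigr => i _; rewrite exprMn mulrAC.
    apply: (le_trans (expR_taylor_bound _ _)).
    rewrite normrM (gtr0_norm u0) exprMn -mulrA ler_wpM2l ?exprn_ge0 ?(ltW u0)//.
    by rewrite ler_wpM2l ?exprn_ge0// ler_expR ler_piMl.
have ur : u ^+ r <= 1 by rewrite exprn_ile1// ltW.
have ur0 : 0 <= u ^+ r by rewrite exprn_ge0// ltW.
split.
- have -> : F u = p.[u] + (F u - p.[u]) by ring.
  by rewrite (le_trans (ler_normD _ _))// lerD// (le_trans E1)// ler_piMr.
- by rewrite (le_trans b)// lerDl.
- by rewrite (le_trans E1)// ler_wpM2r// lerDr.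
Qed.

Lemma moment_of_mgf (q : {poly R}) r i : eq_upto r F (fun u => q.[u]) -> (i < r)%N ->
  (\int[P]_w (V w ^+ i)%:E = (i`!%:R * q`_i)%:E)%E.
Proof.
move=> Fq ir.
have := eq_upto_poly (eq_upto_trans (eq_upto_sym (mgf_eq_upto r)) Fq) ir.
rewrite coef_poly ir => <-.
rewrite mulrC divfK ?pnatr_eq0 -?lt0n ?fact_gt0// fineK//.
by apply: integrable_fin_num => //; exact: mgf_integrable_moment.
Qed.

End moments_of_mgf.

(** The index set is that of compositions of [r] into [n] positive parts; bounding the parts by [r]
    loses none of them. *)
Definition composition_sum {R : realType} (a : nat -> R) (r n : nat) : R :=
  \sum_(m : {ffun 'I_n -> 'I_r.+1} |
         ((\sum_(l < n) m l)%N == r) && [forall l, (0 < m l)%N])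
    \prod_(l < n) a (m l).

Lemma coef_exp_composition_sum {R : realType} (a : nat -> R) (r n : nat) :
  ((\sum_(m < r.+1 | (0 < m)%N) a m *: 'X^m) ^+ n)`_r = composition_sum a r n.
Proof.
rewrite -[in LHS](card_ord n) -prodr_const.
rewrite (bigA_distr_big (fun m : 'I_r.+1 => (0 < m)%N)
  (fun (_ : 'I_n) (m : 'I_r.+1) => a m *: 'X^m)) coef_sum.
rewrite /composition_sum [RHS]big_mkcondl/= [LHS]big_mkcond [RHS]big_mkcond.
apply: eq_bigr => f _.
have -> : (f \in ffun_on (fun m : 'I_r.+1 => (0 < m)%N)) = [forall l, (0 < f l)%N].
  by apply/ffun_onP/forallP.
case: ifP => // _.
have -> : \prod_(i < n) (a (f i) *: 'X^(f i)) =
    (\prod_(i < n) a (f i)) *: 'X^(\sum_(i < n) f i)%N.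
  elim/big_rec3: _ => [|i y x z _ ->]; first by rewrite expr0 scale1r.
  by rewrite -scalerAl -scalerAr scalerA -exprD.
by rewrite coefZ coefXn eq_sym; case: eqP => _; rewrite ?mulr1 ?mulr0.
Qed.

(** For [m >= 1] this is the [m]th derivative of [skellam_exponent] at [0], that is, the [m]th
    cumulant of the Skellam process at time [1]; [jump_coef] is the corresponding Taylor
    coefficient. *)
Definition jump_cumulant {R : realType} (k : nat) (lam mu : 'I_k -> R) (m : nat) : R :=
  \sum_(i < k) (i.+1%:R ^+ m * lam i + (-1) ^+ m * i.+1%:R ^+ m * mu i).

Definition jump_coef {R : realType} (k : nat) (lam mu : 'I_k -> R) (m : nat) : R :=
  (m`!%:R)^-1 * jump_cumulant lam mu m.

Section gsp_moments.
Context {R : realType} (k : nat) (lam mu : 'I_k -> R).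

Let p (r : nat) : {poly R} := \sum_(m < r.+1 | (0 < m)%N) jump_coef lam mu m *: 'X^m.

Lemma eq_upto_expRB1 r (c : R) :
  eq_upto r.+1 (fun u => expR (u * c) - 1)
               (fun u => \sum_(m < r.+1 | (0 < m)%N) c ^+ m / m`!%:R * u ^+ m).
Proof.
have h : eq_upto r.+1 (fun u => expR (u * c))
    (fun u => \sum_(i < r.+1) (u * c) ^+ i / i`!%:R).
  apply: (@eq_upto_expR _ _ _ `|c|) => // u u0 u1.
  by rewrite normrM (gtr0_norm u0) mulrC.
apply: eq_upto_ext (eq_uptoD h (eq_upto_cst _ (- 1))) => // u.
rewrite [RHS]big_mkcond/= !big_ord_recl/= expr0 divr1 add0r addrAC subrr add0r.
by apply: eq_bigr => i _; rewrite exprMn; ring.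
Qed.

Lemma skellam_exponent_eq_upto r :
  eq_upto r.+1 (skellam_exponent lam mu) (fun u => (p r).[u]).
Proof.
have h (i : 'I_k) : eq_upto r.+1
    (fun u => lam i * (expR (u * i.+1%:R) - 1) + mu i * (expR (- (u * i.+1%:R)) - 1))
    (fun u => lam i * (\sum_(m < r.+1 | (0 < m)%N) i.+1%:R ^+ m / m`!%:R * u ^+ m) +
       mu i * (\sum_(m < r.+1 | (0 < m)%N) (- i.+1%:R) ^+ m / m`!%:R * u ^+ m)).
  apply: eq_uptoD; apply: eq_uptoM (eq_upto_cst _ _) _; first exact: eq_upto_expRB1.
  by apply: eq_upto_ext (eq_upto_expRB1 r (- i.+1%:R)) => // u; rewrite mulrN.
apply: eq_upto_ext (eq_upto_sum (index_enum 'I_k) (fun i _ => h i)) => [//|u].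
rewrite /p horner_sum /=; under [RHS]eq_bigr do rewrite hornerZ hornerXn.
under [LHS]eq_bigr do rewrite !mulr_sumr -big_split/=.
rewrite exchange_big/=; apply: eq_bigr => m _.
rewrite /jump_coef /jump_cumulant mulr_sumr mulr_suml; apply: eq_bigr => i _.
by rewrite (exprNn i.+1%:R); ring.
Qed.

(** The exponent is [O(u)], so truncating the outer exponential at degree [r] costs only
    [O(u^(r+1))]; inside each remaining power the exponent can then be replaced by its own Taylor
    polynomial. *)
Lemma gsp_exponent_eq_upto (t : R) r :
  eq_upto r.+1 (fun u => expR (t * skellam_exponent lam mu u))
    (fun u => (\sum_(n < r.+1) (t ^+ n / n`!%:R) *: p r ^+ n).[u]).
Proof.
(* The polynomial [p 0] is an empty sum, so its order-one estimate is exactly the bound [C * u] on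
   the exponent. *)
have [C C0 H] : eq_upto 1 (skellam_exponent lam mu) (fun=> 0).
  apply: eq_upto_ext (skellam_exponent_eq_upto 0) => // u.
  by rewrite /p big_mkcond big_ord1/= horner0.
have h : eq_upto r.+1 (fun u => t * skellam_exponent lam mu u)
    (fun u => t * (p r).[u]).
  by apply: eq_uptoM (eq_upto_cst _ _) _; exact: skellam_exponent_eq_upto.
apply: (@eq_upto_trans _ _ _ (fun u => \sum_(i < r.+1) (t * skellam_exponent lam mu u) ^+ i / i`!%:R)).
  apply: (@eq_upto_expR _ _ _ (`|t| * C)); first by rewrite mulr_ge0.
  move=> u u0 u1; have [_ _] := H u u0 u1.
  by rewrite subr0 expr1 normrM -mulrA => h1; rewrite ler_wpM2l.
have h2 (i : 'I_r.+1) : eq_upto r.+1 (fun u => (t * skellam_exponent lam mu u) ^+ i / i`!%:R)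
    (fun u => (t * (p r).[u]) ^+ i / i`!%:R).
  by apply: eq_uptoM; [exact: eq_uptoX|exact: eq_upto_cst].
apply: eq_upto_ext (eq_upto_sum (index_enum 'I_r.+1) (fun i _ => h2 i)) => [//|u].
rewrite [RHS]horner_sum /=; apply: eq_bigr => i _.
by rewrite hornerZ horner_exp exprMn mulrAC.
Qed.

Lemma gsp_moment d (T : measurableType d) (P : probability T R) (S : R -> T -> R)
    (t : R) (r : nat) : gsp P lam mu S -> 0 <= t -> (0 < r)%N ->
  (\int[P]_w (S t w ^+ r)%:E =
   (r`!%:R * \sum_(1 <= n < r.+1) t ^+ n / n`!%:R *
      composition_sum (jump_coef lam mu) r n)%:E)%E.
Proof.
move=> gS t0 r0.
rewrite (moment_of_mgf (gsp_measurable gS t0) (fun u => gsp_mgf gS u t0)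
  (gsp_exponent_eq_upto t r) (ltnSn r)).
congr (_ * _)%:E; rewrite coef_sum.
rewrite -(big_mkord xpredT (fun n => ((t ^+ n / n`!%:R) *: p r ^+ n)`_r)).
(* The term [n = 0] is a constant polynomial and has no coefficient at [r > 0], which is why the sum
   starts at [1]. *)
rewrite big_ltn// expr0 coefZ coef1 (gtn_eqF r0) mulr0 add0r.
apply: eq_bigr => n _.
by rewrite coefZ coef_exp_composition_sum.
Qed.

End gsp_moments.

(** * Gamma integrals and uniqueness of Laplace transforms *)

Section half_line_integrals.
Context {R : realType}.
Local Notation mu := (@lebesgue_measure R).
Local Notation D0 := (`]0%R, +oo[%classic : set R).

Lemma mule_injl (a : R) (x y : \bar R) : a != 0 -> (a%:E * x = a%:E * y)%E -> x = y.
Proof.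
move=> a0 /(congr1 (mule (a^-1)%:E)).
by rewrite !muleA -EFinM mulVf// !mul1e.
Qed.

(** Lebesgue measure equals [a] times its image under [x -> a x]: the two agree on half-open
    intervals, and uniqueness does the rest. *)
Lemma ge0_integral_scale (a : R) (f : R -> \bar R) : 0 < a ->
  measurable_fun setT f -> (forall x, 0 <= f x)%E ->
  (a%:E * \int[mu]_(x in D0) f (a * x)%R = \int[mu]_(x in D0) f x)%E.
Proof.
move=> a0 mf f0.
have ma : measurable_fun setT ((fun x : R => a * x) : _ -> measurableTypeR R).
  exact: measurable_funM.
pose nu : {measure set (measurableTypeR R) -> \bar R} :=
  measure_function_pushforward__canonical__measure_function_Measure mu ma.
pose m' : {measure set (measurableTypeR R) -> \bar R} := mscale (NngNum (ltW a0)) nu.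
have H : forall A, measurable A -> mu A = m' A.
  apply: lebesgue_measure_unique => _ [[x y] _ <-].
  rewrite /m' /= /mscale/= /pushforward.
  have -> : (fun z : R => a * z) @^-1` `]x, y] = `](x / a), (y / a)]%classic.
    by apply/seteqP; split => z /=; rewrite !in_itv/= ltr_pdivrMr// ler_pdivlMr// (mulrC z).
  rewrite !lebesgue_measure_itv/= !lte_fin ltr_pM2r ?invr_gt0//.
  case: ifPn => _; last by rewrite mule0.
  by rewrite -!EFinB -EFinM -mulrBl mulrCA divff ?mulr1// lt0r_neq0.
transitivity (\int[m']_(x in D0) f x)%E; last first.
  by apply: eq_measure_integral => A mA _; apply/esym/H.
rewrite /m' ge0_integral_mscale//; last exact: measurable_funTS.
rewrite /= ge0_integral_pushforward//; last exact: measurable_funTS.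
congr (_ * _)%E; congr (integral _ _ _).
by apply/seteqP; split => x /=; rewrite !in_itv/= !andbT pmulr_rgt0.
Qed.

Lemma integral_exp_tail (y : R) : 
  (\int[mu]_(x in `]y, +oo[) (expR (- x))%:E = (expR (- y))%:E)%E.
Proof.
have cexp : continuous (fun x : R => expR (- x)).
  move=> x; apply: continuous_comp; last exact: continuous_expR.
  exact: (@continuousN _ R^o).
rewrite integral_itv_obnd_cbnd; last first.
  apply/measurable_EFinP; apply: measurable_funTS.
  exact: continuous_measurable_fun.
rewrite (@ge0_continuous_FTC2y _ _ (fun x => - expR (- x)) _ 0).
- by rewrite EFinN oppeK add0e.
- by move=> x _; exact: expR_ge0.
- exact: continuous_subspaceT.
- by rewrite -oppr0; apply: cvgN; exact: cvgr_expR.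
- by move=> x _; exact: ex_derive.
- by apply: cvg_at_right_filter; apply: cvgN; exact: cexp.
- move=> x _; rewrite derive1N// derive1E.
  by rewrite derive_val mulrN1 opprK.
Qed.

(** The layer-cake form of a power: with Tonelli it turns moments into integrals of tail
    probabilities. *)
Lemma integral_layer (n : nat) (y : R) : 0 <= y ->
  (\int[mu]_(x in D0) (n.+1%:R * x ^+ n * (x < y)%R%:R)%:E = (y ^+ n.+1)%:E)%E.
Proof.
rewrite le_eqVlt => /predU1P[<-|y0].
  rewrite integral0_eq ?expr0n// => x /=; rewrite in_itv/= andbT => x0.
  by rewrite ltNge (ltW x0) mulr0.
transitivity (\int[mu]_(x in `]0%R, y[) (n.+1%:R * x ^+ n)%:E)%E.
  rewrite integral_mkcond [RHS]integral_mkcond; apply: eq_integral => x _.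
  rewrite !patchE.
  have [xD|xD] := boolP (x \in `]0%R, y[%classic).
    move: xD; rewrite inE/= in_itv/= => /andP[x0 xy].
    by rewrite mem_set/= ?in_itv/= ?x0// xy mulr1.
  case: ifPn => // xD'.
  have -> : (x < y) = false; last by rewrite mulr0.
  apply/negP => xy; move/negP: xD; apply.
  by move: xD'; rewrite !inE/= !in_itv/= andbT => ->.
have cf : continuous (fun x : R => n.+1%:R * x ^+ n).
  by move=> x; apply: cvgM; [exact: cvg_cst|exact: exprn_continuous].
rewrite -(integral_itv_bndoo true false); last first.
  apply/measurable_EFinP; apply: measurable_funTS.
  exact: continuous_measurable_fun.
rewrite (@continuous_FTC2 _ _ (fun x => x ^+ n.+1))//.
- by rewrite expr0n/= sube0.
- exact: continuous_subspaceT.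
- split.
  + by move=> x _; exact: exprn_derivable.
  + by apply: cvg_at_right_filter; exact: exprn_continuous.
  + by apply: cvg_at_left_filter; exact: exprn_continuous.
- by move=> x _; rewrite exp_derive1.
Qed.

Let mE : measurable_fun setT (fun x : R => expR (- x)).
Proof. by apply: measurableT_comp => //; exact: measurable_funN. Qed.

Lemma measurable_lt_ind d (T : measurableType d) (f g : T -> R) : measurable_fun setT f -> measurable_fun setT g ->
  measurable_fun setT (fun z => (f z < g z)%R%:R : R).
Proof.
move=> mf mg.
rewrite (_ : (fun z => _) = (fun z => if (f z < g z)%R then 1 else 0)); last first.
  by apply/funext => z; case: ifP.
by apply: measurable_fun_ifT => //; exact: measurable_fun_ltr.
Qed.

Lemma integral_factorial (n : nat) :
  (\int[mu]_(x in D0) (x ^+ n * expR (- x))%:E = (n`!%:R)%:E)%E.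
Proof.
elim: n => [|n IH].
  under eq_integral do rewrite expr0 mul1r.
  by rewrite integral_exp_tail oppr0 expR0.
(* Induction by Tonelli in place of integration by parts: expand [y^(n+1)] in layers, then integrate
   [exp (- y)] over [y > x]. The absolute value makes the integrand nonnegative on the whole plane,
   as [ge0_fubini_on] demands. *)
transitivity (\int[mu]_(y in D0) \int[mu]_(x in D0)
    (n.+1%:R * `|x| ^+ n * (x < y)%R%:R * expR (- y))%:E)%E.
  apply: eq_integral => y; rewrite inE/= in_itv/= andbT => y0.
  rewrite EFinM -integral_layer ?ltW// muleC -ge0_integralZl_EFin ?expR_ge0//.
  - apply: eq_integral => x; rewrite inE/= in_itv/= andbT => x0.
    by rewrite gtr0_norm// -EFinM mulrC.
  - move=> x; rewrite /= in_itv/= andbT => x0.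
    by rewrite lee_fin !mulr_ge0// exprn_ge0// ltW.
  - apply/measurable_EFinP; apply: measurable_funTS; apply: measurable_funM.
      by apply: measurable_funM => //; exact: measurable_funX.
    exact: measurable_lt_ind.
rewrite (@ge0_fubini_on R _ _ _ _ mu mu D0 D0 (fun z : R * R =>
  (n.+1%:R * `|z.2| ^+ n * (z.2 < z.1)%R%:R * expR (- z.1))%:E))//; first last.
- apply/measurable_EFinP; apply: measurable_funM; last first.
    exact: (measurableT_comp (f := fun x : R => expR (- x))).
  apply: measurable_funM; last exact: measurable_lt_ind.
  by apply: measurable_funM => //; apply: measurable_funX; exact: measurableT_comp.
transitivity (\int[mu]_(x in D0) ((n.+1%:R)%:E * (x ^+ n * expR (- x))%:E))%E.
  apply: eq_integral => x; rewrite inE/= in_itv/= andbT => x0.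
  rewrite -EFinM mulrA EFinM -integral_exp_tail -ge0_integralZl_EFin//; first last.
  - by rewrite mulr_ge0// exprn_ge0// ltW.
  - by apply/measurable_EFinP; exact: measurable_funTS.
  rewrite [LHS]integral_mkcond [RHS]integral_mkcond; apply: eq_integral => y _.
  rewrite !patchE.
  have [yD|yD] := boolP (y \in `]x, +oo[%classic).
    move: yD; rewrite inE/= in_itv/= andbT => xy.
    by rewrite mem_set/= ?in_itv/= ?(lt_trans x0 xy)// xy mulr1 gtr0_norm// -EFinM.
  case: ifPn => // yD'.
  have -> : (x < y) = false; last by rewrite mulr0 mul0r.
  by apply/negP => xy; move/negP: yD; apply; rewrite inE/= in_itv/= xy.
rewrite ge0_integralZl_EFin//.
- by rewrite IH -EFinM factS natrM.
- move=> x; rewrite /= in_itv/= andbT => x0.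
  by rewrite lee_fin mulr_ge0 ?expR_ge0// exprn_ge0// ltW.
- apply/measurable_EFinP; apply: measurable_funTS; exact: measurable_funM.
Qed.

Lemma integral_power_exp (n : nat) (a : R) : 0 < a ->
  (\int[mu]_(x in D0) (n.+1%:R * x ^+ n * expR (- (a * x)))%:E =
   (n.+1`!%:R / a ^+ n.+1)%:E)%E.
Proof.
move=> a0.
have am0 : a ^+ n != 0 by rewrite expf_neq0// lt0r_neq0.
have mf : measurable_fun setT (fun x : R => (n.+1%:R * (`|x| / a) ^+ n * expR (- x))%:E).
  apply/measurable_EFinP; apply: measurable_funM => //.
  apply: measurable_funM => //; apply: measurable_funX.
  by apply: measurable_funM => //; exact: measurableT_comp.
have sc := ge0_integral_scale a0 mf.
apply: (mule_injl (lt0r_neq0 a0)).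
rewrite -[RHS]EFinM.
have -> : a * (n.+1`!%:R / a ^+ n.+1) = n.+1`!%:R / a ^+ n.
  by rewrite exprS invfM mulrCA [a * _]mulrA divff ?mul1r// lt0r_neq0.
transitivity (a%:E * \int[mu]_(x in D0) (n.+1%:R * (`|(a * x)%R| / a) ^+ n * expR (- (a * x)))%:E)%E.
  congr (_ * _)%E; apply: eq_integral => x; rewrite inE/= in_itv/= andbT => x0.
  by rewrite gtr0_norm ?mulr_gt0// [a * x]mulrC mulfK ?lt0r_neq0.
rewrite sc; last by move=> x; rewrite lee_fin !mulr_ge0 ?exprn_ge0 ?expR_ge0 ?divr_ge0// ltW.
transitivity (\int[mu]_(x in D0) ((n.+1%:R / a ^+ n)%:E * (x ^+ n * expR (- x))%:E))%E.
  apply: eq_integral => x; rewrite inE/= in_itv/= andbT => x0.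
  by rewrite gtr0_norm// -EFinM; congr EFin; rewrite exprMn exprVn; ring.
rewrite ge0_integralZl_EFin//.
- by rewrite integral_factorial -EFinM factS natrM; congr EFin; ring.
- move=> x; rewrite /= in_itv/= andbT => x0.
  by rewrite lee_fin mulr_ge0 ?expR_ge0// exprn_ge0// ltW.
- apply/measurable_EFinP; apply: measurable_funTS; exact: measurable_funM.
- by rewrite divr_ge0// exprn_ge0// ltW.
Qed.

Lemma integral_powR_exp_lty (b : R) : 0 <= b ->
  (\int[mu]_(x in D0) (x `^ b * expR (- x))%:E < +oo)%E.
Proof.
(* An integer above [b] gives [x^b <= 1 + x^n] on the half line, reducing the claim to
   factorials. *)
move=> b0; pose n := (Num.truncn b).+1.
have bn : b <= n%:R by rewrite ltW// truncnS_gt.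
apply: (@le_lt_trans _ _ (\int[mu]_(x in D0)
   ((x ^+ 0 * expR (- x))%:E + (x ^+ n * expR (- x))%:E))%E); last first.
  rewrite ge0_integralD//.
  - by rewrite !integral_factorial -EFinD ltry.
  - by move=> x _; rewrite lee_fin mulr_ge0 ?expR_ge0.
  - apply/measurable_EFinP; apply: measurable_funTS; exact: measurable_funM.
  - move=> x; rewrite /= in_itv/= andbT => x0.
    by rewrite lee_fin mulr_ge0 ?expR_ge0// exprn_ge0// ltW.
  - apply/measurable_EFinP; apply: measurable_funTS; exact: measurable_funM.
apply: ge0_le_integral => //.
- by move=> x _; rewrite lee_fin mulr_ge0 ?expR_ge0 ?powR_ge0.
- apply/measurable_EFinP; apply: measurable_funTS; exact: measurable_funM.
- apply: emeasurable_funD; apply/measurable_EFinP; apply: measurable_funTS;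
    exact: measurable_funM.
move=> x; rewrite /= in_itv/= andbT => x0.
rewrite -EFinD lee_fin -mulrDl ler_wpM2r ?expR_ge0// expr0.
have [x1|x1] := leP 1 x.
  by rewrite (le_trans (ler_powR x1 bn))// powR_mulrn ?(ltW x0)// lerDr.
apply: (@le_trans _ _ 1); last by rewrite lerDl exprn_ge0// ltW.
have <- : 1 `^ b = 1 :> R by rewrite powR1.
by apply: ge0_ler_powR; rewrite ?nnegrE ?(ltW x0) ?(ltW x1).
Qed.

Lemma integral_GammaE (b : R) : 0 <= b ->
  (\int[mu]_(x in D0) (x `^ b * expR (- x))%:E = (Gamma (b + 1))%:E)%E.
Proof.
move=> b0; rewrite /Gamma addrK /Rintegral fineK// ge0_fin_numE.
  exact: integral_powR_exp_lty.
by apply: integral_ge0 => x _; rewrite lee_fin mulr_ge0 ?expR_ge0 ?powR_ge0.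
Qed.

Lemma Gamma_natS (n : nat) : Gamma (n%:R + 1) = n`!%:R :> R.
Proof.
apply: EFin_inj; rewrite -integral_GammaE// -integral_factorial.
apply: eq_integral => x; rewrite inE/= in_itv/= andbT => x0.
by rewrite powR_mulrn// ltW.
Qed.

(** On [[1, 2]] the integrand is at least [exp (- 2)], because [x^b >= 1] there. *)
Lemma Gamma_gt0 (b : R) : 0 <= b -> 0 < Gamma (b + 1).
Proof.
move=> b0; rewrite -lte_fin -integral_GammaE//.
apply: (@lt_le_trans _ _ (\int[mu]_(x in `[1%R, 2%R]) (expR (- 2))%:E)%E).
  rewrite integral_cst//= lebesgue_measure_itv/= lte_fin ltr1n -EFinD -EFinM lte_fin.
  by rewrite mulr_gt0 ?expR_gt0//; lra.
apply: (@le_trans _ _ (\int[mu]_(x in `[1%R, 2%R]) (x `^ b * expR (- x))%:E)%E).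
  apply: ge0_le_integral => //.
  - apply/measurable_EFinP; apply: measurable_funTS; exact: measurable_funM.
  - move=> x; rewrite /= in_itv/= => /andP[x1 x2].
    rewrite lee_fin -[X in X <= _]mul1r ler_pM ?expR_ge0//.
      have <- : 1 `^ b = 1 :> R by rewrite powR1.
      by apply: ge0_ler_powR; rewrite ?nnegrE// (le_trans ler01 x1).
    by rewrite ler_expR lerN2.
apply: ge0_subset_integral => //.
- apply/measurable_EFinP; apply: measurable_funTS; exact: measurable_funM.
- by move=> x _; rewrite lee_fin mulr_ge0 ?expR_ge0 ?powR_ge0.
- by move=> x /=; rewrite !in_itv/= andbT => /andP[x1 _]; exact: lt_le_trans x1.
Qed.

Lemma integral_powR_exp (b s : R) : 0 <= b -> 0 < s ->
  (\int[mu]_(x in D0) (x `^ b * expR (- (s * x)))%:E =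
   (Gamma (b + 1) * s `^ (- (b + 1)))%:E)%E.
Proof.
move=> b0 s0.
have mf : measurable_fun setT (fun x : R => (x `^ b * expR (- x))%:E).
  apply/measurable_EFinP; exact: measurable_funM.
have sc := ge0_integral_scale s0 mf.
have sb : 0 < s `^ (b + 1) by rewrite powR_gt0.
rewrite powRN.
apply: (mule_injl (lt0r_neq0 sb)).
rewrite -EFinM mulrCA divff ?lt0r_neq0// mulr1 -integral_GammaE// -sc; last first.
  by move=> x; rewrite lee_fin mulr_ge0 ?powR_ge0 ?expR_ge0.
rewrite powRD; last by rewrite (lt0r_neq0 s0) implybT.
rewrite (powRr1 (ltW s0)) mulrC EFinM -muleA.
congr (_ * _)%E.
rewrite -ge0_integralZl_EFin ?powR_ge0//.
- apply: eq_integral => x; rewrite inE/= in_itv/= andbT => x0.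
  by rewrite -EFinM powRM ?ltW// mulrA.
- by move=> x _; rewrite lee_fin mulr_ge0 ?powR_ge0 ?expR_ge0.
- apply/measurable_EFinP; apply: measurable_funTS; apply: measurable_funM => //.
  by apply: measurableT_comp => //; apply: measurable_funN; exact: measurable_funM.
Qed.

End half_line_integrals.

(** * Inversion of Laplace transforms from their values at integers *)

Section laplace_unique.
Context {R : realType}.
Local Notation mu := (@lebesgue_measure R).
Local Notation D0 := (`]0%R, +oo[%classic : set R).

Section kernel.
Variable k : R -> R.
Hypothesis ik : mu.-integrable D0 (fun t => (k t)%:E).
Hypothesis k0 : forall m : nat, (\int[mu]_(t in D0) (expR (- (m%:R * t)) * k t)%:E = 0)%E.

Let mk : measurable_fun D0 k.
Proof. by have /integrableP[/measurable_EFinP] := ik. Qed.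

Let mexp (c : R) : measurable_fun D0 (fun t : R => expR (- (c * t))).
Proof.
apply: measurable_funTS; apply: measurableT_comp => //.
by apply: measurable_funN; exact: measurable_funM.
Qed.

Let integrable_bounded (u : R -> R) (C : R) : measurable_fun D0 u ->
  (forall t, D0 t -> `|u t| <= C) -> mu.-integrable D0 (fun t => (u t * k t)%:E).
Proof.
move=> mu_ uC; apply: le_integrable (@integrableZl _ _ _ mu _ (measurable_itv _) C _ ik) => //.
  by apply/measurable_EFinP; exact: measurable_funM.
move=> t tD; rewrite -EFinM !abse_EFin lee_fin !normrM ler_wpM2r//.
by rewrite (le_trans (uC _ tD))// ler_norm.
Qed.

(* Both exp(- y e^(-N t)) and its limit are reached through power series in
   e^(-N t); with y = e^(N a) and N -> oo they converge to the indicator of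
   t > a, which inverts the Laplace transform from its values at integers. *)
Lemma integral_gumbel_eq0 (N : nat) (y : R) : 0 <= y ->
  (\int[mu]_(t in D0) (expR (- (y * expR (- (N%:R * t)))) * k t)%:E = 0)%E.
Proof.
move=> y0.
pose z t := - (y * expR (- (N%:R * t))).
have zy t : D0 t -> `|z t| <= y.
  rewrite /= in_itv/= andbT => t0.
  rewrite /z normrN ger0_norm ?mulr_ge0 ?expR_ge0// ler_piMr//.
  by rewrite expR_le1 oppr_le0 mulr_ge0// ltW.
have mz : measurable_fun D0 z.
  by apply: measurable_funN; apply: measurable_funM => //; exact: mexp.
pose s K t := \sum_(i < K) z t ^+ i / i`!%:R.
have ms K : measurable_fun D0 (s K).
  apply: measurable_sum => i; apply: measurable_funM => //.
  exact: measurable_funX.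
have se K t : D0 t -> `|s K t| <= expR y.
  move=> tD; rewrite (le_trans (ler_norm_sum _ _ _))//.
  apply: (@le_trans _ _ (\sum_(0 <= i < K) exp_coeff y i)).
    rewrite big_mkord; apply: ler_sum => i _.
    rewrite normrM normrX normfV [`|i`!%:R|]ger0_norm// ler_wpM2r ?invr_ge0//.
    by apply: lerXn2r; rewrite ?nnegrE ?zy.
  apply: (nondecreasing_cvgn_le (u_ := series (exp_coeff y))).
    apply/nondecreasing_seqP => n; rewrite /series/= big_nat_recr//= lerDl.
    exact: exp_coeff_ge0.
  exact: is_cvg_series_exp_coeff.
have sc t : s K t @[K --> \oo] --> expR (z t).
  rewrite [X in X @ _ --> _](_ : _ = series (exp_coeff (z t))).
    exact: is_cvg_series_exp_coeff.
  by apply/funext => K; rewrite /s /series/= big_mkord.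
have [] // := @dominated_convergence _ _ _ mu D0 (measurable_itv _)
  (fun K t => (s K t * k t)%:E) (fun t => (expR (z t) * k t)%:E)
  (fun t => (expR y)%:E * `|(k t)%:E|)%E.
- by move=> K; apply/measurable_EFinP; exact: (measurable_funM (ms K) mk).
- apply/measurable_EFinP; apply: measurable_funM => //.
  exact: measurableT_comp.
- apply: aeW => t tD; apply/fine_cvgP; split; first exact: nearW.
  by apply: (cvgM (sc t)); exact: cvg_cst.
- by apply: integrableZl => //; exact: integrable_abse.
- apply: aeW => t K tD; rewrite abse_EFin lee_fin normrM ler_wpM2r//.
  exact: se.
move=> _ _; rewrite [X in X @ _ --> _](_ : _ = cst 0%E).
  by move=> /cvg_unique h; apply: h => //; exact: cvg_cst.
apply/funext => K /=.
(* The [i]th power of [exp (- N t)] is again an exponential at an integer, [N i], so [k0]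
   annihilates every term of the partial sum. *)
transitivity (\int[mu]_(t in D0) \sum_(i < K)
    ((- y) ^+ i / i`!%:R)%:E * (expR (- ((N * i)%:R * t)) * k t)%:E)%E.
  apply: eq_integral => t _; rewrite /s mulr_suml -sumEFin; apply: eq_bigr => i _.
  rewrite -EFinM; congr EFin; rewrite /z -mulNr exprMn -expRM_natl.
  have -> : i%:R * - (N%:R * t) = - ((N * i)%:R * t) by rewrite natrM; ring.
  by ring.
rewrite integral_sum//.
- rewrite big1// => i _; rewrite integralZl//.
    by rewrite k0 mule0.
  apply: (integrable_bounded (C := 1)); first exact: mexp.
  move=> t; rewrite /= in_itv/= andbT => t0.
  by rewrite ger0_norm ?expR_ge0// expR_le1 oppr_le0 mulr_ge0// ltW.
- move=> i; apply: integrableZl => //.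
  apply: (integrable_bounded (C := 1)); first exact: mexp.
  move=> t; rewrite /= in_itv/= andbT => t0.
  by rewrite ger0_norm ?expR_ge0// expR_le1 oppr_le0 mulr_ge0// ltW.
Qed.

Lemma integral_tail_eq0 (a : R) : 0 < a -> (\int[mu]_(t in `]a, +oo[) (k t)%:E = 0)%E.
Proof.
move=> a0.
pose G (N : nat) t := expR (- (expR (N%:R * a) * expR (- (N%:R * t)))).
have cN (c : R) : 0 < c -> N%:R * c @[N --> \oo] --> +oo.
  move=> c0; apply/cvgryPge => A.
  by apply: filterS (nbhs_infty_ger (A / c)) => n; rewrite ler_pdivrMr.
have GE N t : G N t = expR (- expR (N%:R * (a - t))).
  by rewrite /G -expRD mulrBr.
have G1 N t : `|G N t| <= 1.
  by rewrite ger0_norm ?expR_ge0// GE expR_le1 oppr_le0 expR_ge0.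
have [] // := @dominated_convergence _ _ _ mu D0 (measurable_itv _)
  (fun N t => (G N t * k t)%:E) ((fun t => (k t)%:E) \_ (`]a, +oo[))
  (fun t => `|(k t)%:E|)%E.
- move=> N; apply/measurable_EFinP; apply: measurable_funM => //.
  apply: measurableT_comp => //; apply: measurable_funN.
  by apply: measurable_funM => //; exact: mexp.
- apply/measurable_restrict => //.
  apply: (@measurable_funS _ _ _ _ D0) => //; last exact/measurable_EFinP.
(* At [t = a] the kernel is constantly [exp (- 1)] and does not converge to the indicator; this
   single point is null. *)
- have : mu.-negligible [set a].
    by apply/negligibleP => //; exact: lebesgue_measure_set1.
  apply: negligibleS => t /= /not_implyP[tD tn]; apply: contrapT => /eqP ta.
  apply: tn; move: ta; rewrite neq_lt patchE => /orP[ta|ta].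
    rewrite memNset/= ?in_itv/= ?andbT; last by apply/negP; rewrite -leNgt ltW.
    apply/fine_cvgP; split; first exact: nearW.
    rewrite -[X in _ --> X](mul0r (k t)); apply: cvgM; last exact: cvg_cst.
    rewrite (_ : G ^~ t = (fun x => expR (- x)) \o (fun N => expR (N%:R * (a - t)))); last first.
      by apply/funext => N; rewrite GE.
    apply: (cvg_comp _ _ _ (@cvgr_expR R)).
    apply: (@ger_cvgy _ _ _ _ (fun N : nat => N%:R * (a - t))).
      by apply: nearW => N; rewrite (le_trans _ (expR_ge1Dx _))// lerDr.
    by apply: cN; rewrite subr_gt0.
  rewrite mem_set/= ?in_itv/= ?ta//.
  apply/fine_cvgP; split; first exact: nearW.
  rewrite -[X in _ --> X](mul1r (k t)); apply: cvgM; last exact: cvg_cst.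
  rewrite (_ : G ^~ t = (fun x => expR (- x)) \o (fun N : nat => expR (- (N%:R * (t - a))))); last first.
    by apply/funext => N; rewrite GE/= -mulrN opprB.
  rewrite -[X in _ --> X]expR0 -[X in _ --> expR X]oppr0.
  apply: continuous_cvg.
    apply: continuous_comp; last exact: continuous_expR.
    exact: (@continuousN _ R^o).
  apply: (@cvg_comp _ _ _ (fun N : nat => N%:R * (t - a)) (fun x => expR (- x)) _ +oo%R _ _ (@cvgr_expR R)).
  by apply: cN; rewrite subr_gt0.
- exact: integrable_abse.
- apply: aeW => t N tD; rewrite abse_EFin lee_fin normrM ler_piMl//.
move=> _ _; rewrite [X in X @ _ --> _](_ : _ = cst 0%E); last first.
  by apply/funext => N /=; rewrite integral_gumbel_eq0// expR_ge0.
move=> h; have : (0%E = \int[mu]_(x in D0) ((fun t => (k t)%:E) \_ `]a, +oo[) x)%E.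
  by apply: (cvg_unique _ (cvg_cst _) h).
rewrite -integral_mkcondr => ->; congr (integral _ _ _).
apply/seteqP; split => t /=; rewrite !in_itv/= !andbT; last by case.
by move=> ta; split=> //; exact: lt_trans ta.
Qed.

(** The integral of [k] over []a, b]] is a difference of two vanishing tails, while a lower bound
    [c] would make it at least [c (b - a) > 0]. *)
Lemma kernel_not_bounded_below (a b c : R) : 0 < a -> a < b -> 0 < c ->
  ~ (forall t, a < t <= b -> c <= k t).
Proof.
move=> a0 ab c0 ck.
have b0 : 0 < b by exact: lt_trans ab.
have sub : `]a, b] `<=` D0.
  by move=> t /=; rewrite !in_itv/= andbT => /andP[at_ _]; exact: lt_trans at_.
have iab : (\int[mu]_(t in `]a, b]) (k t)%:E = 0)%E.
  have h := integral_tail_eq0 a0.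
  have UE : `]a, +oo[%classic = `]a, b] `|` `]b, +oo[ :> set R.
    apply/seteqP; split => t /=; rewrite !in_itv/= !andbT.
      by move=> ->/=; case: (leP t b) => _; [left|right].
    by case=> [/andP[]//|]; exact: lt_trans.
  move: h; rewrite UE integral_setU//.
  - by rewrite integral_tail_eq0// adde0.
  - apply: (@measurable_funS _ _ _ _ D0) => //; last exact/measurable_EFinP.
    by rewrite -UE => t /=; rewrite !in_itv/= !andbT => at_; exact: lt_trans at_.
  - apply/disj_setPS => t [] /=; rewrite !in_itv/= andbT => /andP[_ tb] bt.
    by move: (le_lt_trans tb bt); rewrite ltxx.
have : (\int[mu]_(t in `]a, b]) c%:E <= \int[mu]_(t in `]a, b]) (k t)%:E)%E.
  apply: ge0_le_integral => //.
  - by move=> t _; rewrite lee_fin ltW.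
  - by apply: (@measurable_funS _ _ _ _ D0) => //; exact/measurable_EFinP.
rewrite iab integral_cst//= lebesgue_measure_itv/= lte_fin ab -EFinD -EFinM lee_fin.
by rewrite leNgt mulr_gt0// subr_gt0.
Qed.

End kernel.

(** A gap at [t0] spreads to an interval. If [g t0 > h t0], monotonicity of [g] and continuity of
    [h] keep half the gap just to the right of [t0]; if [g t0 < h t0], they keep it just to the
    left. Either contradicts [kernel_not_bounded_below]. *)
Lemma laplace_unique (g h : R -> R) :
  mu.-integrable D0 (fun t => (expR (- t) * g t)%:E) ->
  mu.-integrable D0 (fun t => (expR (- t) * h t)%:E) ->
  (forall m : nat, \int[mu]_(t in D0) (expR (- (m.+1%:R * t)) * g t)%:E =
    \int[mu]_(t in D0) (expR (- (m.+1%:R * t)) * h t)%:E)%E ->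
  (forall s t, 0 < s -> s <= t -> g s <= g t) ->
  (forall t, 0 < t -> {for t, continuous h}) ->
  forall t, 0 < t -> g t = h t.
Proof.
move=> ig ih gh ndg ch t0 t00.
(* The factor [exp (- t)] makes the difference integrable and shifts the known transform values from
   [1, 2, ...] to [0, 1, ...], as the kernel lemmas expect. *)
pose k t := expR (- t) * g t - expR (- t) * h t.
have kE t : k t = expR (- t) * (g t - h t) by rewrite mulrBr.
have ik : mu.-integrable D0 (fun t => (k t)%:E).
  exact: (@integrableB _ _ _ mu D0 (measurable_itv _) _ _ ig ih).
have iw (m : nat) (u : R -> R) : mu.-integrable D0 (fun t => (expR (- t) * u t)%:E) ->
    mu.-integrable D0 (fun t => (expR (- (m.+1%:R * t)) * u t)%:E).
  move=> iu; apply: (le_integrable _ _ _ iu) => //.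
    apply/measurable_EFinP.
    have /integrableP[/measurable_EFinP mu_ _] := iu.
    rewrite (_ : (fun t => _) = (fun t => expR (- (m%:R * t)) * (expR (- t) * u t))); last first.
      by apply/funext => t; rewrite mulrA -expRD -natr1; congr (expR _ * _); ring.
    apply: measurable_funM => //; apply: measurable_funTS; apply: measurableT_comp => //.
    by apply: measurable_funN; exact: measurable_funM.
  move=> t; rewrite /= in_itv/= andbT => tp.
  rewrite lee_fin !normrM ler_wpM2r// !ger0_norm ?expR_ge0// ler_expR lerN2.
  by rewrite ler_peMl ?(ltW tp)// ler1n.
have k0 (m : nat) : (\int[mu]_(t in D0) (expR (- (m%:R * t)) * k t)%:E = 0)%E.
  transitivity (\int[mu]_(t in D0) ((expR (- (m.+1%:R * t)) * g t)%:E - (expR (- (m.+1%:R * t)) * h t)%:E))%E.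
    apply: eq_integral => t _; rewrite -EFinB; congr EFin.
    rewrite kE mulrA -expRD -mulrBr; congr (expR _ * _).
    by rewrite -natr1; ring.
  rewrite integralB//; [|exact: iw|exact: iw].
  by rewrite gh subee//; apply: integrable_fin_num => //; exact: iw.
have ikN : mu.-integrable D0 (fun t => (- k t)%:E) by exact: (integrableN ik).
have k0N (m : nat) : (\int[mu]_(t in D0) (expR (- (m%:R * t)) * - k t)%:E = 0)%E.
  transitivity (\int[mu]_(t in D0) ((-1)%:E * (expR (- (m%:R * t)) * k t)%:E))%E.
    by apply: eq_integral => t _; rewrite -EFinM mulN1r mulrN.
  rewrite integralZl ?k0 ?mule0//.
  apply: (@eq_integrable _ _ _ mu D0 (measurable_itv _) _ _ _ (@integrableB _ _ _ mu D0 (measurable_itv _) _ _ (iw m _ ig) (iw m _ ih))).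
  move=> t _; rewrite /= -EFinB; congr EFin.
  rewrite kE mulrA -expRD -mulrBr; congr (expR _ * _).
  by rewrite -natr1; ring.
apply/eqP; rewrite eq_le; apply/andP; split; rewrite leNgt; apply/negP => lt0.
- pose e := (g t0 - h t0) / 2.
  have e0 : 0 < e by rewrite /e; lra.
  have /cvgr_dist_lt/(_ _ e0) := ch t0 t00.
  move=> [r /= r0 Hr].
  apply: (kernel_not_bounded_below ik k0 (a := t0) (b := t0 + r / 2)
    (c := expR (- (t0 + r / 2)) * e)) => //.
  + by rewrite ltrDl divr_gt0.
  + by rewrite mulr_gt0 ?expR_gt0.
  move=> t /andP[t0t tr].
  rewrite kE ler_pM ?expR_ge0 ?(ltW e0)//.
    by rewrite ler_expR lerN2.
  have := Hr t _; rewrite /= distrC ger0_norm ?subr_ge0 ?(ltW t0t)//.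
  have rr : t - t0 < r by lra.
  move=> /(_ rr); rewrite ltr_norml => /andP[h1 h2].
  have := ndg _ _ t00 (ltW t0t); rewrite /e in h1 *; lra.
- pose e := (h t0 - g t0) / 2.
  have e0 : 0 < e by rewrite /e; lra.
  have /cvgr_dist_lt/(_ _ e0) := ch t0 t00.
  move=> [r /= r0 Hr].
  (* The first entry keeps the left endpoint positive, the second keeps it within the continuity
     radius of [t0]. *)
  pose a := Num.max (t0 / 2) (t0 - r / 2).
  have a0 : 0 < a by rewrite lt_max divr_gt0.
  have at0 : a < t0 by rewrite gt_max; apply/andP; split; lra.
  apply: (kernel_not_bounded_below ikN k0N (a := a) (b := t0)
    (c := expR (- t0) * e)) => //.
  + by rewrite mulr_gt0 ?expR_gt0.
  move=> t /andP[at_ tt0].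
  rewrite kE -mulrN ler_pM ?expR_ge0 ?(ltW e0)//.
    by rewrite ler_expR lerN2.
  have := Hr t _; rewrite /= ger0_norm ?subr_ge0//.
  have rr : t0 - t < r.
    by move: at_; rewrite gt_max => /andP[_]; lra.
  move=> /(_ rr); rewrite ltr_norml => /andP[h1 h2].
  have := ndg t t0 (lt_trans a0 at_) tt0; rewrite /e in h2 *; lra.
Qed.

End laplace_unique.

(** * The inverse stable subordinator *)

Section inverse_process_paths.
Context {R : realType} d (T : measurableType d).
Variable D : R -> T -> R.
Hypothesis D_nd : forall w s t, 0 <= s -> s <= t -> D s w <= D t w.

Local Notation Y := (inverse_process D).
Let A t w := [set x : R | 0 <= x /\ t < D x w].

Let lbA t w : lbound (A t w) 0.
Proof. by move=> x []. Qed.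

Let hlbA t w : has_lbound (A t w).
Proof. by exists 0; exact: lbA. Qed.

Let inverse_process_le t w x : A t w x -> Y t w <= x.
Proof. by move=> Ax; apply: ge_inf Ax; exact: hlbA. Qed.

Lemma inverse_process_ge0 t w : 0 <= Y t w.
Proof.
have [A0|/set0P A0] := eqVneq (A t w) set0.
  by rewrite /inverse_process -/(A t w) A0 inf0.
exact: (lb_le_inf A0 (@lbA t w)).
Qed.

Lemma le_of_lt_inverse_process t w x : 0 <= x -> x < Y t w -> D x w <= t.
Proof.
move=> x0 xY; rewrite leNgt; apply/negP => tD.
have : Y t w <= x by exact: inverse_process_le.
by rewrite leNgt xY.
Qed.

Lemma inverse_process_ge t w x : A t w !=set0 -> 0 <= x -> D x w <= t -> x <= Y t w.
Proof.
move=> A0 x0 Dxt; apply: lb_le_inf => // y [y0 tD].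
rewrite leNgt; apply/negP => yx.
by move: (lt_le_trans tD (D_nd w y0 (ltW yx))); rewrite ltNge Dxt.
Qed.

(** If the defining set is empty at [t], it stays empty for larger [s] and [Y] is constantly [0].
    Otherwise take [x] in it with [x < Y t w + e]: for [t < s < D x w] the same [x] is admissible at
    [s], so [Y t w <= Y s w <= x]. *)
Lemma inverse_process_right_continuous w t : Y s w @[s --> t^'+] --> Y t w.
Proof.
have [A0|/set0P A0] := eqVneq (A t w) set0.
  have Yt : Y t w = 0 by rewrite /inverse_process -/(A t w) A0 inf0.
  rewrite Yt; apply: cvg_near_cst; near=> s.
  have ts : t < s by near: s; exact: nbhs_right_gt.
  rewrite /inverse_process -/(A s w) (_ : A s w = set0) ?inf0//.
  apply/seteqP; split => x //= [x0 sD].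
  have : A t w x by split=> //; exact: lt_trans sD.
  by rewrite A0.
apply/cvgrPdist_lt => e e0.
have [x [x0 tx] xY] := inf_adherent e0 (conj A0 (@hlbA t w)).
near=> s.
have ts : t < s by near: s; exact: nbhs_right_gt.
have sD : s < D x w by near: s; exact: nbhs_right_lt.
have Ys : Y s w <= x by exact: inverse_process_le.
have As : A s w !=set0 by exists x.
have tYs : Y t w <= Y s w.
  apply: lb_le_inf => // y [y0 sy]; apply: inverse_process_le.
  by split=> //; exact: lt_trans sy.
rewrite ler0_norm ?subr_le0// opprB ltrBlDl (le_lt_trans Ys)//.
Unshelve. all: by end_near. Qed.

(** Global monotonicity can fail, since [Y] drops to the default [0] once the set is empty. A
    nonempty set at [t] is still nonempty for [s] slightly larger, which gives the local version. *)
Lemma inverse_process_nondecreasing_near w t : \forall s \near t^'+, Y t w <= Y s w.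
Proof.
have [A0|/set0P A0] := eqVneq (A t w) set0.
  by near=> s; rewrite {1}/inverse_process -/(A t w) A0 inf0 inverse_process_ge0.
have [x [x0 tx]] := A0.
near=> s.
have ts : t < s by near: s; exact: nbhs_right_gt.
have sD : s < D x w by near: s; exact: nbhs_right_lt.
apply: lb_le_inf; first by exists x.
move=> y [y0 sy]; apply: inverse_process_le.
by split=> //; exact: lt_trans sy.
Unshelve. all: by end_near. Qed.

(** Since [Y s w] approaches [Y t w] from above, the right limit of [S] applies; where the two times
    coincide there is nothing to prove, and this case is split off because the right filter is
    punctured. *)
Lemma right_continuous_time_change (S : R -> R) (w : T) (t : R) :
  S s @[s --> (Y t w)^'+] --> S (Y t w) ->
  S (Y s w) @[s --> t^'+] --> S (Y t w).
Proof.
move=> Sr; apply/cvgrPdist_lt => e e0.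
have /cvgrPdist_lt/(_ _ e0)[r /= r0 Hr] := Sr.
have /cvgrPdist_lt/(_ _ r0) := @inverse_process_right_continuous w t.
have := inverse_process_nondecreasing_near w t.
apply: filterS2 => s le_Y dist_Y.
move: le_Y; rewrite le_eqVlt => /predU1P[<-|lt_Y]; first by rewrite subrr normr0.
exact: Hr.
Qed.

(** For [a > 0], [Y t w < a] holds either because some rational [0 <= q < a] has [t < D q w], or
    because the defining set is empty and [Y t w = 0]. By monotonicity of [D] emptiness is detected
    on integer times. *)
Lemma measurable_inverse_process (t : R) :
  (forall s, 0 <= s -> measurable_fun setT (D s)) -> measurable_fun setT (Y t).
Proof.
move=> mD.
have mlt s : 0 <= s -> measurable [set w | t < D s w].
  move=> s0; have := mD s s0 measurableT _ (measurable_itv `]t, +oo[).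
  by rewrite setTI; congr measurable; apply/seteqP; split => w /=; rewrite in_itv/= andbT.
move=> _; apply: (measurability _ (RGenInftyO.measurableE R)) => //= _ [_ [a ->] <-]; rewrite setTI.
have [a0|a0] := leP a 0.
  rewrite (_ : _ @^-1` _ = set0)//; apply/seteqP; split => w //=.
  by rewrite in_itv/= ltNge (le_trans a0)// inverse_process_ge0.
rewrite (_ : _ @^-1` _ =
  (\bigcup_(q : rat) (if (0 <= (ratr q : R) < a) then [set w | t < D (ratr q) w] else set0)) `|`
  ~` (\bigcup_n [set w | t < D n%:R w])).
  apply: measurableU.
    apply: bigcupT_measurable_rat => q; case: ifPn => // /andP[q0 _]; exact: mlt.
  apply: measurableC; apply: bigcup_measurable => n _; exact: mlt.
apply/seteqP; split => w /=; rewrite in_itv/=.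
  move=> Ya.
  have [A0|/set0P A0] := eqVneq (A t w) set0.
    right => -[n _ /= tD]; have : A t w n%:R by split.
    by rewrite A0.
  left; have [x [x0 tx] xa] := inf_lt A0 Ya.
  have [q] := rat_in_itvoo xa; rewrite in_itv/= => /andP[xq qa].
  exists q => //; rewrite qa (le_trans x0 (ltW xq))/=.
  exact: lt_le_trans tx (D_nd w x0 (ltW xq)).
move=> [[q _]|nD].
  case: ifPn => // /andP[q0 qa] /= tD; apply: le_lt_trans qa.
  exact: inverse_process_le.
rewrite /inverse_process -/(A t w) (_ : A t w = set0) ?inf0//.
apply/seteqP; split => x //= [x0 tD]; apply: nD.
exists (Num.truncn x).+1 => //=; apply: lt_le_trans tD (D_nd w x0 _).
by rewrite ltW// truncnS_gt.
Qed.

End inverse_process_paths.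

Lemma measurable_integral_on {R : realType} d1 d2 (T1 : measurableType d1)
    (T2 : measurableType d2) (m1 : {sigma_finite_measure set T1 -> \bar R})
    (A : set T1) (f : T1 * T2 -> \bar R) :
  measurable A -> measurable_fun [set: T1 * T2] f -> (forall z, 0 <= f z)%E ->
  measurable_fun setT (fun y => \int[m1]_(x in A) f (x, y))%E.
Proof.
move=> mA mf f0.
have mA1 : measurable [set z : T1 * T2 | A z.1].
  by have := @measurable_fst _ _ T1 T2 measurableT _ mA; rewrite setTI.
apply: (eq_measurable_fun (fubini_G m1 (f \_ [set z | A z.1]))).
  move=> y _; rewrite /fubini_G [RHS]integral_mkcond; apply: eq_integral => x _.
  rewrite !patchE.
  have -> : ((x, y) \in [set z : T1 * T2 | A z.1]) = (x \in A).
    by apply/idP/idP; rewrite !inE.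
  by [].
apply: measurable_fun_fubini_tonelli_G.
  by apply/(measurable_restrictT _ mA1); exact: measurable_funTS.
by move=> z; rewrite patchE; case: ifP.
Qed.

(** * Moments of the inverse stable subordinator *)

Section inverse_stable_moments.
Context {R : realType} d (T : measurableType d) (P : probability T R).
Variables (alpha : R) (D : R -> T -> R).
Hypothesis alpha0 : 0 < alpha.
Hypothesis sD : stable_subordinator P alpha D.
Local Notation mu := (@lebesgue_measure R).
Local Notation D0 := (`]0%R, +oo[%classic : set R).
Local Notation Y := (inverse_process D).

Lemma subordinator_measurable (f : R -> R) (X : R -> T -> R) t :
  levy_subordinator P f X -> 0 <= t -> measurable_fun setT (X t).
Proof. by case=> -[+ _ _ _ _] _ _ _ _; exact. Qed.

Lemma subordinator_right_continuous (f : R -> R) (X : R -> T -> R) w t :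
  levy_subordinator P f X -> 0 <= t -> X s w @[s --> t^'+] --> X t w.
Proof. by case=> -[_ _ _ _ c] _ _ _ _; have [h _] := c w; exact: h. Qed.

Let D_ge0 w t : 0 <= t -> 0 <= D t w.
Proof. by case: sD => _ + _ _ _; exact. Qed.

Let D_nd w s t : 0 <= s -> s <= t -> D s w <= D t w.
Proof. by case: sD => _ _ + _ _; exact. Qed.

Let D_laplace s t : 0 < s -> 0 <= t ->
  (\int[P]_w (expR (- (s * D t w)))%:E = (expR (- (t * s `^ alpha)))%:E)%E.
Proof. by case: sD => _ _ _ _ H s0 t0; rewrite -H// unlock. Qed.

Let mD t : 0 <= t -> measurable_fun setT (D t).
Proof. exact: subordinator_measurable sD. Qed.

Lemma measurable_le_ind d' (T' : measurableType d') (f g : T' -> R) :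
  measurable_fun setT f -> measurable_fun setT g ->
  measurable_fun setT (fun z => (f z <= g z)%R%:R : R).
Proof.
move=> mf mg.
rewrite (_ : (fun z => _) = (fun z => if (f z <= g z)%R then 1 else 0)); last first.
  by apply/funext => z; case: ifP.
by apply: measurable_fun_ifT => //; exact: measurable_fun_ler.
Qed.

(** The absolute value keeps the time nonnegative, the only range where [D] is controlled, so that
    [N] is measurable on the whole product space. *)
Let N (x t : R) (w : T) : R := (D `|x| w <= t)%R%:R.

Let N0 x t w : 0 <= N x t w. Proof. exact: ler0n. Qed.

(** Joint measurability of [D] in time and sample point, obtained by treating the time coordinate as
    a random time on [T']. *)
Let mDabs d' (T' : measurableType d') (u : T' -> R) (v : T' -> T) :
  measurable_fun setT u -> measurable_fun setT v ->
  measurable_fun setT (fun z => D `|u z| (v z)).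
Proof.
move=> mu_ mv.
apply: (measurable_time_change (X := fun q z => D q (v z)) (U := fun z => `|u z|)).
- by move=> q q0; apply: measurableT_comp => //; exact: mD.
- by move=> z q q0; exact: (@subordinator_right_continuous _ _ (v z) q sD q0).
- exact: measurableT_comp.
- by move=> z; exact: normr_ge0.
Qed.

Let mN d' (T' : measurableType d') (u s : T' -> R) (v : T' -> T) :
  measurable_fun setT u -> measurable_fun setT s -> measurable_fun setT v ->
  measurable_fun setT (fun z => N (u z) (s z) (v z)).
Proof. by move=> mu_ ms mv; apply: measurable_le_ind => //; exact: mDabs. Qed.

Let F (x t : R) : \bar R := (\int[P]_w (N x t w)%:E)%E.

Let F0 x t : (0 <= F x t)%E.
Proof. by apply: integral_ge0 => w _; rewrite lee_fin. Qed.

Let mF : measurable_fun [set: R * R] (fun z => F z.1 z.2).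
Proof.
apply: (measurable_fun_fubini_tonelli_F (m2 := P)
  (fun z : (R * R) * T => (N z.1.1 z.1.2 z.2)%:E)) => //.
  apply/measurable_EFinP; apply: mN => //.
  - by apply: (measurableT_comp (f := fst)).
  - by apply: (measurableT_comp (f := snd)).
by move=> z; rewrite lee_fin.
Qed.

(** Chernoff's bound at [s = 1]: the indicator of [D x <= t] is at most [exp (t - D x)], and
    [1^alpha = 1]. *)
Let F_le x t : 0 <= x -> (F x t <= (expR t * expR (- x))%:E)%E.
Proof.
move=> x0.
have -> : ((expR t * expR (- x))%:E = \int[P]_w ((expR t)%:E * (expR (- (1 * D x w)))%:E))%E.
  rewrite ge0_integralZl_EFin ?expR_ge0//.
  - by rewrite D_laplace// powR1 mulr1 EFinM.
  - apply/measurable_EFinP; apply: measurableT_comp => //; apply: measurable_funN.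
    by apply: measurable_funM => //; exact: mD.
apply: ge0_le_integral => //.
- by move=> w _; rewrite lee_fin.
- by apply/measurable_EFinP; exact: mN.
- apply: measurable_funeM; apply/measurable_EFinP; apply: measurableT_comp => //.
  by apply: measurable_funN; apply: measurable_funM => //; exact: mD.
- move=> w _; rewrite -EFinM lee_fin /N mul1r -expRD ger0_norm//.
  have [Dt|_] := leP (D x w) t; last exact: expR_ge0.
  by rewrite -expR0 ler_expR subr_ge0.
Qed.

(** Emptiness forces [D n <= t] for every integer [n], an event of probability at most
    [exp (t - n)]. *)
Lemma inverse_stable_nonempty t : {ae P, forall w, [set x : R | 0 <= x /\ t < D x w] !=set0}.
Proof.
pose B := \bigcap_n [set w | D n%:R w <= t].
have mB1 n : measurable [set w | D n%:R w <= t].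
  have := mD (ler0n R n) measurableT (measurable_itv `]-oo, t]).
  by rewrite setTI; congr measurable; apply/seteqP; split => w /=; rewrite in_itv.
have mB : measurable B by apply: bigcap_measurable => // n _; exact: mB1.
exists B; split => //.
- apply/eqP; rewrite eq_le measure_ge0 andbT.
  have cv : (expR t * expR (- n%:R))%:E @[n --> \oo] --> 0%E.
    apply/fine_cvgP; split; first exact: nearW.
    rewrite -[X in _ --> X](mulr0 (expR t)); apply: cvgM; first exact: cvg_cst.
    exact: (@cvg_comp _ _ _ (fun n : nat => n%:R) (fun x => expR (- x)) _ +oo%R _ cvgr_idn (@cvgr_expR R)).
  apply: (cvge_to_ge cv); apply: nearW => n.
  apply: le_trans (F_le t (ler0n R n)).
  rewrite /F -(setIT B) -integral_indic//.
  apply: ge0_le_integral => //.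
  + exact/measurable_EFinP.
  + by apply/measurable_EFinP; exact: mN.
  + move=> w _; rewrite lee_fin indicE.
    have [wB|//] := boolP (w \in B).
    by move: wB; rewrite inE => /(_ n Logic.I) /=; rewrite /N ger0_norm// => ->.
move=> w /= H n _ /=; rewrite leNgt; apply/negP => tD; apply: H.
by exists n%:R.
Qed.

Let g (n : nat) (t : R) : \bar R := (\int[mu]_(x in D0) ((n.+1%:R * `|x| ^+ n)%:E * F x t))%E.

Let g0 n t : (0 <= g n t)%E.
Proof.
by apply: integral_ge0 => x _; rewrite mule_ge0// lee_fin mulr_ge0// exprn_ge0.
Qed.

Let mw n : measurable_fun setT (fun x : R => n.+1%:R * `|x| ^+ n).
Proof.
by apply: measurable_funM => //; apply: measurable_funX; exact: normr_measurable.
Qed.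

Let mF1 t : measurable_fun setT (F^~ t).
Proof. exact: (measurable_fun_pair1 t mF). Qed.

Let mF2 x : measurable_fun setT (F x).
Proof. exact: (measurable_fun_pair2 x mF). Qed.

Let mwF n t : measurable_fun setT (fun x : R => (n.+1%:R * `|x| ^+ n)%:E * F x t)%E.
Proof.
by apply: emeasurable_funM; [apply/measurable_EFinP; exact: mw|exact: mF1].
Qed.

Let g_le n t : (g n t <= (expR t * n.+1`!%:R)%:E)%E.
Proof.
have -> : ((expR t * n.+1`!%:R)%:E =
    \int[mu]_(x in D0) ((expR t)%:E * (n.+1%:R * x ^+ n * expR (- (1 * x)))%:E))%E.
  rewrite ge0_integralZl_EFin ?expR_ge0//.
  - by rewrite integral_power_exp// expr1n divr1 EFinM.
  - move=> x; rewrite /= in_itv/= andbT => x0.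
    by rewrite lee_fin !mulr_ge0 ?expR_ge0// exprn_ge0// ltW.
  - apply/measurable_EFinP; apply: measurable_funTS; apply: measurable_funM; first exact: measurable_funM.
    by apply: measurableT_comp => //; apply: measurable_funN; exact: measurable_funM.
rewrite /g; apply: ge0_le_integral => //.
- by move=> x _; rewrite mule_ge0// lee_fin mulr_ge0// exprn_ge0.
- by apply: measurable_funTS; exact: mwF.
- apply: measurable_funTS; apply: measurable_funeM; apply/measurable_EFinP.
  apply: measurable_funM; first exact: measurable_funM.
  by apply: measurableT_comp => //; apply: measurable_funN; exact: measurable_funM.
- move=> x; rewrite /= in_itv/= andbT => x0.
  rewrite gtr0_norm//.
  apply: (le_trans (lee_wpmul2l _ (F_le t (ltW x0)))).
    by rewrite lee_fin mulr_ge0// exprn_ge0// ltW.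
  by rewrite -!EFinM lee_fin mul1r mulrCA.
Qed.

Let g_fin n t : g n t \is a fin_num.
Proof. by rewrite ge0_fin_numE// (le_lt_trans (g_le n t))// ltry. Qed.

Let F_nd x s t : s <= t -> (F x s <= F x t)%E.
Proof.
move=> st; apply: ge0_le_integral => //.
- by move=> w _; rewrite lee_fin.
- by apply/measurable_EFinP; exact: mN.
- by apply/measurable_EFinP; exact: mN.
- move=> w _; rewrite lee_fin /N.
  by have [h|//] := leP (D `|x| w) s; rewrite (le_trans h st).
Qed.

Let g_nd n s t : s <= t -> (g n s <= g n t)%E.
Proof.
move=> st; rewrite /g; apply: ge0_le_integral => //.
- by move=> x _; rewrite mule_ge0// lee_fin mulr_ge0// exprn_ge0.
- by apply: measurable_funTS; exact: mwF.
- by apply: measurable_funTS; exact: mwF.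
- move=> x _; rewrite lee_wpmul2l ?F_nd// lee_fin mulr_ge0// exprn_ge0//.
Qed.

Let mg n : measurable_fun setT (g n).
Proof.
have mh : measurable_fun [set: R * R] (fun z =>
    (n.+1%:R * `|z.1| ^+ n)%:E * F z.1 z.2)%E.
  apply: emeasurable_funM => //; apply/measurable_EFinP.
  exact: (measurableT_comp (mw n) measurable_fst).
apply: (@measurable_integral_on _ _ _ _ _ mu D0 _ _ mh) => // z.
by rewrite mule_ge0// lee_fin mulr_ge0// exprn_ge0.
Qed.

(** Write the power in layers. For almost every path, [x < Y t w] and [D x w <= t] agree for all
    [x > 0] except possibly [x = Y t w], a null set; Tonelli then brings in [F]. *)
Lemma integral_inverse_stable n t :
  (\int[P]_w (Y t w ^+ n.+1)%:E = g n t)%E.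
Proof.
have mY : measurable_fun setT (Y t) by apply: measurable_inverse_process.
have mDN : measurable_fun [set: T * R] (fun z => (n.+1%:R * `|z.2| ^+ n * N z.2 t z.1)%:E).
  apply/measurable_EFinP; apply: measurable_funM; last exact: mN.
  exact: (measurableT_comp (mw n) measurable_snd).
have DN0 z : (0 <= (n.+1%:R * `|z.2| ^+ n * N z.2 t z.1)%:E)%E.
  by rewrite lee_fin mulr_ge0// mulr_ge0// exprn_ge0.
transitivity (\int[P]_w \int[mu]_(x in D0) (n.+1%:R * `|x| ^+ n * N x t w)%:E)%E.
  apply: ae_eq_integral => //.
  - by apply/measurable_EFinP; exact: measurable_funX.
  - apply: (@measurable_integral_on _ _ _ _ _ mu D0
      (fun z : R * T => (n.+1%:R * `|z.1| ^+ n * N z.1 t z.2)%:E)) => //.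
      apply/measurable_EFinP; apply: measurable_funM; last exact: mN.
      exact: (measurableT_comp (mw n) measurable_fst).
    by move=> z; rewrite lee_fin mulr_ge0// mulr_ge0// exprn_ge0.
  apply: filterS (inverse_stable_nonempty t) => w A0 _.
  rewrite -integral_layer ?inverse_process_ge0//.
  apply: ae_eq_integral => //.
  - apply: measurable_funTS; apply/measurable_EFinP; apply: measurable_funM.
      exact: measurable_funM.
    exact: measurable_lt_ind.
  - apply: measurable_funTS; apply/measurable_EFinP; apply: measurable_funM.
      exact: mw.
    exact: mN.
  have : mu.-negligible [set Y t w].
    by apply/negligibleP => //; exact: lebesgue_measure_set1.
  apply: negligibleS => x /= /not_implyP[xD xn]; apply: contrapT => /eqP xY.
  apply: xn; move: xD; rewrite in_itv/= andbT => x0.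
  rewrite (gtr0_norm x0) /N (gtr0_norm x0); congr (_ * (nat_of_bool _)%:R)%:E.
  move: xY; rewrite neq_lt => /orP[xY|Yx].
    by rewrite xY (le_of_lt_inverse_process (ltW x0) xY).
  rewrite ltNge (ltW Yx)/=; apply/esym/negbTE; apply/negP => Dx.
  have := inverse_process_ge D_nd A0 (ltW x0) Dx.
  by rewrite leNgt Yx.
rewrite (@ge0_fubini_on R _ _ _ _ P mu setT D0 (fun z => (n.+1%:R * `|z.2| ^+ n * N z.2 t z.1)%:E))//.
apply: eq_integral => x _; rewrite /F -ge0_integralZl_EFin//.
- by move=> w _; rewrite lee_fin.
- by apply/measurable_EFinP; exact: mN.
Qed.

Let integral_exp_ge (c : R) : 0 <= c ->
  (\int[mu]_(u in D0) (expR (- u) * (c <= u)%R%:R)%:E = (expR (- c))%:E)%E.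
Proof.
move=> c0.
have mE : measurable_fun setT (fun u : R => expR (- u)).
  by apply: measurableT_comp => //; exact: measurable_funN.
transitivity (\int[mu]_(u in D0) (expR (- u) * (c < u)%R%:R)%:E)%E.
  apply: ae_eq_integral => //.
  - apply: measurable_funTS; apply/measurable_EFinP; apply: measurable_funM => //.
    exact: measurable_le_ind.
  - apply: measurable_funTS; apply/measurable_EFinP; apply: measurable_funM => //.
    exact: measurable_lt_ind.
  have : mu.-negligible [set c].
    by apply/negligibleP => //; exact: lebesgue_measure_set1.
  apply: negligibleS => u /= /not_implyP[_ un]; apply: contrapT => /eqP uc.
  by apply: un; rewrite lt_neqAle eq_sym uc.
rewrite -integral_exp_tail integral_mkcond [RHS]integral_mkcond.
apply: eq_integral => u _; rewrite !patchE.
have [uD|uD] := boolP (u \in `]c, +oo[%classic).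
  move: uD; rewrite inE/= in_itv/= andbT => cu.
  by rewrite mem_set/= ?in_itv/= ?(le_lt_trans c0 cu)// cu mulr1.
case: ifPn => // _.
have -> : (c < u) = false; last by rewrite mulr0.
by apply/negP => cu; move/negP: uD; apply; rewrite inE/= in_itv/= cu.
Qed.

Let integral_exp_step (c s : R) : 0 <= c -> 0 < s ->
  (\int[mu]_(t in D0) (expR (- (s * t)) * (c <= t)%R%:R)%:E = (expR (- (s * c)) / s)%:E)%E.
Proof.
move=> c0 s0.
have mf : measurable_fun setT (fun u : R => (expR (- u) * (s * c <= u)%R%:R)%:E).
  apply/measurable_EFinP; apply: measurable_funM.
    by apply: measurableT_comp => //; exact: measurable_funN.
  exact: measurable_le_ind.
have sc := ge0_integral_scale s0 mf.
apply: (mule_injl (lt0r_neq0 s0)).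
rewrite -[RHS]EFinM mulrCA divff ?lt0r_neq0// mulr1.
rewrite -integral_exp_ge ?mulr_ge0 ?(ltW s0)// -sc; last first.
  by move=> u; rewrite lee_fin mulr_ge0 ?expR_ge0.
by congr (_ * _)%E; apply: eq_integral => t _; rewrite ler_pM2l.
Qed.

(** Integrating in [t] first, the indicator of [D x w <= t] yields [exp (- s D x w) / s]; the
    expectation is then the Laplace transform of [D]. *)
Let laplace_F (x s : R) : 0 <= x -> 0 < s ->
  (\int[mu]_(t in D0) ((expR (- (s * t)))%:E * F x t) =
   (expR (- (s `^ alpha * x)) / s)%:E)%E.
Proof.
move=> x0 s0.
have mE : measurable_fun setT (fun t : R => expR (- (s * t))).
  by apply: measurableT_comp => //; apply: measurable_funN; exact: measurable_funM.
transitivity (\int[mu]_(t in D0) \int[P]_w (expR (- (s * t)) * N x t w)%:E)%E.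
  apply: eq_integral => t _; rewrite /F -ge0_integralZl_EFin ?expR_ge0//.
  - by move=> w _; rewrite lee_fin.
  - by apply/measurable_EFinP; exact: mN.
rewrite (@ge0_fubini_on R _ _ _ _ mu P D0 setT (fun z => (expR (- (s * z.1)) * N x z.1 z.2)%:E))//.
- transitivity (\int[P]_w ((s^-1)%:E * (expR (- (s * D x w)))%:E))%E.
    apply: eq_integral => w _.
    rewrite /N (ger0_norm x0) (integral_exp_step (D_ge0 w x0) s0).
    by rewrite mulrC EFinM.
  rewrite ge0_integralZl_EFin ?invr_ge0 ?(ltW s0)//.
  + by rewrite D_laplace// -EFinM mulrC (mulrC x).
  + by apply/measurable_EFinP; apply: measurableT_comp => //; apply: measurable_funN;
      apply: measurable_funM => //; exact: mD.
- apply/measurable_EFinP; apply: measurable_funM; last exact: mN.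
  exact: (measurableT_comp mE measurable_fst).
- by move=> z; rewrite lee_fin mulr_ge0 ?expR_ge0.
Qed.

Let laplace_g n (s : R) : 0 < s ->
  (\int[mu]_(t in D0) ((expR (- (s * t)))%:E * g n t) =
   (n.+1`!%:R / (s `^ alpha) ^+ n.+1 / s)%:E)%E.
Proof.
move=> s0.
have sa0 : 0 < s `^ alpha by rewrite powR_gt0.
have mE : measurable_fun setT (fun t : R => expR (- (s * t))).
  by apply: measurableT_comp => //; apply: measurable_funN; exact: measurable_funM.
transitivity (\int[mu]_(t in D0) \int[mu]_(x in D0)
    ((expR (- (s * t)))%:E * ((n.+1%:R * `|x| ^+ n)%:E * F x t)))%E.
  apply: eq_integral => t _; rewrite /g -ge0_integralZl_EFin ?expR_ge0//.
  - by move=> x _; rewrite mule_ge0// lee_fin mulr_ge0// exprn_ge0.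
  - by apply: measurable_funTS; exact: mwF.
rewrite (@ge0_fubini_on R _ _ _ _ mu mu D0 D0 (fun z : R * R => ((expR (- (s * z.1)))%:E * ((n.+1%:R * `|z.2| ^+ n)%:E * F z.2 z.1))%E))//.
- transitivity (\int[mu]_(x in D0) ((s^-1)%:E *
      (n.+1%:R * x ^+ n * expR (- (s `^ alpha * x)))%:E))%E.
    apply: eq_integral => x; rewrite inE/= in_itv/= andbT => x0.
    transitivity ((n.+1%:R * x ^+ n)%:E * \int[mu]_(t in D0) ((expR (- (s * t)))%:E * F x t))%E.
      rewrite -ge0_integralZl_EFin//.
      + by apply: eq_integral => t _; rewrite gtr0_norm// muleCA.
      + by move=> t _; rewrite mule_ge0// lee_fin expR_ge0.
      + apply: measurable_funTS; apply: emeasurable_funM; last exact: mF2.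
        exact/measurable_EFinP.
      + by rewrite mulr_ge0// exprn_ge0// ltW.
    by rewrite laplace_F// ?(ltW x0)// -!EFinM; congr EFin; ring.
  rewrite ge0_integralZl_EFin ?invr_ge0 ?(ltW s0)//.
  + by rewrite integral_power_exp// -EFinM mulrC.
  + move=> x; rewrite /= in_itv/= andbT => x0.
    by rewrite lee_fin !mulr_ge0 ?expR_ge0// exprn_ge0// ltW.
  + apply/measurable_EFinP; apply: measurable_funTS; apply: measurable_funM.
      exact: measurable_funM.
    by apply: measurableT_comp => //; apply: measurable_funN; exact: measurable_funM.
- apply: emeasurable_funM.
    apply/measurable_EFinP; exact: (measurableT_comp mE measurable_fst).
  apply: emeasurable_funM.
    apply/measurable_EFinP; exact: (measurableT_comp (mw n) measurable_snd).
  exact: (measurableT_comp mF (measurable_fun_pair measurable_snd measurable_fst)).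
- by move=> z; rewrite !mule_ge0// lee_fin ?expR_ge0// mulr_ge0// exprn_ge0.
Qed.

Lemma inverse_stable_moment n t : 0 <= t ->
  (\int[P]_w (Y t w ^+ n)%:E =
   (n`!%:R * (t `^ (n%:R * alpha) / Gamma (n%:R * alpha + 1)))%:E)%E.
Proof.
move=> t0; case: n => [|n].
  under eq_integral do rewrite expr0.
  rewrite integral_cst// mul1e mul0r powRr0.
  have := @Gamma_natS R 0; rewrite /= fact0 => ->.
  by rewrite divr1 mulr1; exact: probability_setT.
rewrite integral_inverse_stable.
set b := n.+1%:R * alpha.
have b0 : 0 < b by rewrite mulr_gt0.
have Gb : 0 < Gamma (b + 1) by rewrite Gamma_gt0// ltW.
(* Chosen so that [C * u^b] has the Laplace transform computed in [laplace_g]. *)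
pose C := n.+1`!%:R / Gamma (b + 1).
have C0 : 0 <= C by rewrite divr_ge0// ltW.
pose gr u := fine (g n u).
have grE u : (gr u)%:E = g n u by rewrite fineK.
have gr0 u : 0 <= gr u by rewrite fine_ge0.
have gr_nd s v : s <= v -> gr s <= gr v.
  by move=> sv; exact: (fine_le (g_fin n s) (g_fin n v) (g_nd n sv)).
have mgr : measurable_fun setT gr by apply: measurableT_comp => //; exact: mg.
pose h u := C * u `^ b.
have h0 u : 0 <= h u by rewrite mulr_ge0// powR_ge0.
have mh : measurable_fun setT h.
  by apply: measurable_funM => //; exact: measurable_powR.
have Lg s : 0 < s -> (\int[mu]_(u in D0) (expR (- (s * u)) * gr u)%:E =
    (C * Gamma (b + 1) * s `^ (- (b + 1)))%:E)%E.
  move=> s0.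
  transitivity (\int[mu]_(u in D0) ((expR (- (s * u)))%:E * g n u))%E.
    by apply: eq_integral => u _; rewrite EFinM grE.
  rewrite laplace_g//; congr EFin.
  rewrite /C divfK ?lt0r_neq0// powRN powRD; last by rewrite (lt0r_neq0 s0) implybT.
  rewrite powRr1 ?(ltW s0)// invfM mulrA; congr (_ / _ / _).
  by rewrite /b mulrC powRrM powR_mulrn// powR_ge0.
have Lh s : 0 < s -> (\int[mu]_(u in D0) (expR (- (s * u)) * h u)%:E =
    (C * Gamma (b + 1) * s `^ (- (b + 1)))%:E)%E.
  move=> s0.
  transitivity (\int[mu]_(u in D0) (C%:E * (u `^ b * expR (- (s * u)))%:E))%E.
    by apply: eq_integral => u _; rewrite -EFinM /h; congr EFin; ring.
  rewrite ge0_integralZl_EFin//.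
  - by rewrite integral_powR_exp// ?(ltW b0)// -EFinM mulrA.
  - by move=> u _; rewrite lee_fin mulr_ge0 ?powR_ge0 ?expR_ge0.
  - apply: measurable_funTS; apply/measurable_EFinP; apply: measurable_funM.
      exact: measurable_powR.
    by apply: measurableT_comp => //; apply: measurable_funN; exact: measurable_funM.
have integ (u : R -> R) : measurable_fun setT u -> (forall x, 0 <= u x) ->
    (\int[mu]_(x in D0) (expR (- (1 * x)) * u x)%:E = 
      (C * Gamma (b + 1) * 1 `^ (- (b + 1)))%:E)%E ->
    mu.-integrable D0 (fun x => (expR (- x) * u x)%:E).
  move=> mu_ u0 uE; apply/integrableP; split.
    apply: measurable_funTS; apply/measurable_EFinP; apply: measurable_funM => //.
    by apply: measurableT_comp => //; exact: measurable_funN.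
  rewrite (_ : integral _ _ _ = (C * Gamma (b + 1) * 1 `^ (- (b + 1)))%:E) ?ltry//.
  rewrite -uE; apply: eq_integral => x _.
  by rewrite gee0_abs ?mul1r// lee_fin mulr_ge0 ?expR_ge0.
have pos_eq u : 0 < u -> gr u = h u.
  move=> u0; apply: (@laplace_unique _ gr h) u0.
  - by apply: integ => //; exact: Lg.
  - by apply: integ => //; exact: Lh.
  - by move=> m; rewrite Lg// Lh.
  - by move=> s v _ sv; exact: gr_nd.
  - move=> v v0; apply: (@cvgM _ _ _ _ (cst C)); first exact: cvg_cst.
    have dp : derivable (@powR R ^~ b) v 1.
      by apply: derivable_powR; rewrite in_itv/= v0.
    by move/derivable1_diffP/differentiable_continuous : dp.
have -> : n.+1`!%:R * (t `^ b / Gamma (b + 1)) = h t by rewrite /h /C; ring.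
rewrite -grE; congr EFin.
(* Uniqueness speaks only of positive times. At [0], monotonicity bounds the value by [C * u^b] for
   every [u > 0], which tends to [0]. *)
move: t0; rewrite le_eqVlt => /predU1P[<-|t0]; last exact: pos_eq.
rewrite /h powR0 ?lt0r_neq0// mulr0.
apply/eqP; rewrite eq_le gr0 andbT.
have cv : C * u `^ b @[u --> 0^'+] --> 0.
  by rewrite -[X in _ --> X](mulr0 C); apply: cvgM; [exact: cvg_cst|exact: powR_cvg0].
apply: (cvgr_to_ge cv); near=> u.
have u0 : 0 < u by near: u; exact: nbhs_right_gt.
have hE : gr u = C * u `^ b := pos_eq u u0.
by rewrite -hE; exact: gr_nd (ltW u0).
Unshelve. all: by end_near. Qed.

End inverse_stable_moments.

(** * Fractional and time-changed Skellam processes *)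

Lemma integral_prob_cst {R : realType} d (T : measurableType d) (P : probability T R)
  (c : R) : (\int[P]_w c%:E = c%:E)%E.
Proof.
transitivity (c%:E * P setT)%E; first exact: integral_cst.
rewrite -[RHS]mule1; congr (_ * _)%E; exact: probability_setT.
Qed.

Lemma integral_lincomb {R : realType} d (T : measurableType d) (P : probability T R)
    (I : Type) (s : seq I) (f : I -> T -> R) (c v : I -> R) :
  (forall i, P.-integrable setT (fun w => (f i w)%:E)) ->
  (forall i, \int[P]_w (f i w)%:E = (v i)%:E)%E ->
  P.-integrable setT (fun w => (\sum_(i <- s) f i w * c i)%:E) /\
  (\int[P]_w (\sum_(i <- s) f i w * c i)%:E = (\sum_(i <- s) v i * c i)%:E)%E.
Proof.
move=> fi fv.
have E : (fun w => (\sum_(i <- s) f i w * c i)%:E) =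
    (fun w => \sum_(i <- s) (c i)%:E * (f i w)%:E)%E.
  apply/funext => w; rewrite -sumEFin; apply: eq_bigr => i _.
  by rewrite -EFinM mulrC.
have ci i : P.-integrable setT (fun w => (c i)%:E * (f i w)%:E)%E.
  exact: integrableZl.
rewrite E; split; first exact: integrable_sum.
rewrite integral_sum// -sumEFin; apply: eq_bigr => i _.
by rewrite integralZl// fv -EFinM mulrC.
Qed.

Section gfsp.
Context {R : realType} d (T : measurableType d) (P : probability T R).
Variables (k : nat) (lam mu : 'I_k -> R) (alpha : R) (X : R -> T -> R).
Hypothesis alpha01 : 0 < alpha <= 1.
Hypothesis gX : gfsp P alpha lam mu X.

Let inverse_facts (S D : R -> T -> R) t : gsp P lam mu S ->
    stable_subordinator P alpha D -> independent_processes P S (inverse_process D) -> 0 <= t ->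
  [/\ measurable_fun setT (inverse_process D t),
      forall w, 0 <= inverse_process D t w &
      forall q, 0 <= q -> indep_rv P (S q) (inverse_process D t)].
Proof.
move=> gS sD ind t0; split.
- apply: measurable_inverse_process.
    by case: sD => _ _ + _ _; exact.
  by move=> q q0; exact: (subordinator_measurable sD).
- by move=> w; exact: inverse_process_ge0.
- move=> q q0 B C mB mC; apply: ind; exact: process_sigma_preimage.
Qed.

Lemma gfsp_measurable t : 0 <= t -> measurable_fun setT (X t).
Proof.
move=> t0; case: gX => S gS [[_ XS]|[_ [D [sD ind XS]]]].
  by rewrite (_ : X t = S t); [exact: (gsp_measurable gS)|apply/funext => w; exact: XS].
have [mY Y0 _] := inverse_facts gS sD ind t0.
rewrite (_ : X t = (fun w => S (inverse_process D t w) w)); last first.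
  by apply/funext => w; exact: XS.
apply: measurable_time_change => //; first exact: gsp_measurable gS.
by move=> w q q0; exact: (gsp_right_continuous gS).
Qed.

Lemma gfsp_right_continuous w t : 0 <= t -> X s w @[s --> t^'+] --> X t w.
Proof.
move=> t0; case: gX => S gS H.
suff [S' [S'r S'E]] : exists S' : R -> T -> R, S' s w @[s --> t^'+] --> S' t w /\
    forall s, 0 <= s -> X s w = S' s w.
  rewrite S'E//; apply: cvg_trans S'r; apply: near_eq_cvg; near=> s.
  rewrite S'E//; apply: (le_trans t0); apply: ltW; near: s; exact: nbhs_right_gt.
case: H => [[_ XS]|[_ [D [sD ind XS]]]].
  exists S; split; first exact: (gsp_right_continuous gS).
  by move=> s s0; exact: XS.
exists (fun s w => S (inverse_process D s w) w); split; last by move=> s s0; exact: XS.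
apply: (right_continuous_time_change (S := S ^~ w)).
by apply: (gsp_right_continuous gS); exact: inverse_process_ge0.
Unshelve. all: by end_near. Qed.

(* The random time whose law makes X t a Skellam process at an independent time;
   for alpha = 1 it is the constant t. *)
Lemma gfsp_marginal t : 0 <= t -> exists Y : T -> R,
  [/\ measurable_fun setT Y, forall w, 0 <= Y w,
      forall n, (\int[P]_w (Y w ^+ n)%:E =
        (n`!%:R * (t `^ (n%:R * alpha) / Gamma (n%:R * alpha + 1)))%:E)%E,
      forall u, (\int[P]_w (expR (u * X t w))%:E =
        \int[P]_w (expR (skellam_exponent lam mu u * Y w))%:E)%E
    & forall r, (0 < r)%N -> (\int[P]_w (X t w ^+ r)%:E =
        \int[P]_w (r`!%:R * \sum_(1 <= n < r.+1) Y w ^+ n / n`!%:R *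
          composition_sum (jump_coef lam mu) r n)%:E)%E].
Proof.
move=> t0; case: gX => S gS [[a1 XS]|[_ [D [sD ind XS]]]].
  have XE : X t = S t by apply/funext => w; exact: XS.
  exists (fun=> t); rewrite XE; split.
  - exact: measurable_cst.
  - by [].
  (* For [alpha = 1] the Gamma value is [n!], so the general formula reduces to the power [t^n] of
     the constant time. *)
  - move=> n; rewrite integral_prob_cst a1 mulr1 Gamma_natS powR_mulrn//.
    by rewrite mulrC divfK ?pnatr_eq0 -?lt0n ?fact_gt0.
  - by move=> u; rewrite (gsp_mgf gS)// integral_prob_cst mulrC.
  - by move=> r r0; rewrite (gsp_moment gS)// integral_prob_cst.
have [mY Y0 indY] := inverse_facts gS sD ind t0.
have XE : X t = (fun w => S (inverse_process D t w) w).
  by apply/funext => w; exact: XS.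
have alpha0 : 0 < alpha by case/andP: alpha01.
have mom n := inverse_stable_moment alpha0 sD n t0.
have mS q : 0 <= q -> measurable_fun setT (S q) by exact: (gsp_measurable gS).
have cS w q : 0 <= q -> S s w @[s --> q^'+] --> S q w by exact: (gsp_right_continuous gS).
exists (inverse_process D t); rewrite XE; split => //.
- move=> u.
  have cphi : continuous (fun x : R => expR (u * x)).
    move=> x; apply: continuous_comp; last exact: continuous_expR.
    by apply: cvgM; [exact: cvg_cst|exact: cvg_id].
  have [_ ->] := ge0_integral_time_change mS cS mY Y0 indY cphi (fun x => expR_ge0 (u * x)).
  by apply: eq_integral => w _; rewrite (gsp_mgf gS)// mulrC.
- move=> r r0.
  apply: (moments_time_change mS cS mY Y0 indY (g := fun r q =>
    r`!%:R * \sum_(1 <= n < r.+1) q ^+ n / n`!%:R *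
          composition_sum (jump_coef lam mu) r n)) => //.
    by move=> n q n0 q0; rewrite (gsp_moment gS).
  move=> n n0.
  have iY m : P.-integrable setT (fun w => (inverse_process D t w ^+ m)%:E).
    apply/integrableP; split; first by apply/measurable_EFinP; exact: measurable_funX.
    under eq_integral do rewrite gee0_abs ?lee_fin ?exprn_ge0//.
    by rewrite mom ltry.
  have [H _] := integral_lincomb (index_iota 1 n.+1)
    (fun m => (m`!%:R)^-1 * composition_sum (jump_coef lam mu) n m) iY mom.
  apply: (eq_integrable measurableT _ _ _ (integrableZl measurableT (n`!%:R) H)).
  move=> w _; rewrite -EFinM; congr (_ * _)%:E.
  by apply: eq_bigr => m _; rewrite mulrA.
Qed.

(** The [n!] in the moments of the inner time cancels the [1 / n!] of the Skellam moment polynomial,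
    leaving the Gamma factor. *)
Lemma gfsp_moment t r : 0 <= t -> (0 < r)%N ->
  (\int[P]_w (X t w ^+ r)%:E =
    (r`!%:R * \sum_(1 <= n < r.+1) t `^ (n%:R * alpha) *
      ((Gamma (n%:R * alpha + 1))^-1 * composition_sum (jump_coef lam mu) r n))%:E)%E.
Proof.
move=> t0 r0; have [Y [mY Y0 mom _ momX]] := gfsp_marginal t0.
rewrite momX//.
have iY m : P.-integrable setT (fun w => (Y w ^+ m)%:E).
  apply/integrableP; split; first by apply/measurable_EFinP; exact: measurable_funX.
  under eq_integral do rewrite gee0_abs ?lee_fin ?exprn_ge0//.
  by rewrite mom ltry.
have [H HE] := integral_lincomb (index_iota 1 r.+1)
  (fun m => (m`!%:R)^-1 * composition_sum (jump_coef lam mu) r m) iY mom.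
transitivity (\int[P]_w ((r`!%:R)%:E * (\sum_(i <- index_iota 1 r.+1)
    Y w ^+ i * ((i`!%:R)^-1 * composition_sum (jump_coef lam mu) r i))%:E))%E.
  apply: eq_integral => w _; rewrite -EFinM; congr (_ * _)%:E.
  by apply: eq_bigr => m _; rewrite mulrA.
rewrite integralZl// HE -EFinM; congr (_ * _)%:E; apply: eq_bigr => m _.
have f0 : m`!%:R != 0 :> R by rewrite pnatr_eq0 -lt0n fact_gt0.
rewrite [RHS](_ : _ = m`!%:R / m`!%:R * (t `^ (m%:R * alpha) *
  ((Gamma (m%:R * alpha + 1))^-1 * composition_sum (jump_coef lam mu) r m))).
  by ring.
by rewrite divff// mul1r.
Qed.

End gfsp.

(** * Alternating bounds and nonnegative series for the exponential *)

Section exponential_series.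
Context {R : realType}.

(** Induction on [N]: the signed remainder of order [N.+1] vanishes at [0], and its derivative is
    the signed remainder of order [N], nonnegative by hypothesis. *)
Lemma expR_alternating_bound (N : nat) (y : R) : 0 <= y ->
  0 <= (-1) ^+ N * (expR (- y) - \sum_(i < N) (- y) ^+ i / i`!%:R).
Proof.
pose p (N : nat) : {poly R} := \poly_(i < N) ((-1) ^+ i / i`!%:R).
have pE (M : nat) u : (p M).[u] = \sum_(i < M) (- u) ^+ i / i`!%:R.
  rewrite horner_poly; apply: eq_bigr => i _.
  by rewrite (exprNn u i) mulrAC.
have dp (M : nat) : (p M.+1)^`() = - p M.
  apply/polyP => i; rewrite coef_deriv coefN !coef_poly ltnS.
  case: ifP => // _; last by rewrite mul0rn oppr0.
  rewrite factS natrM invfM exprS -[LHS]mulr_natr.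
  set a := i.+1%:R; set b := (i`!%:R)^-1; set x := (-1) ^+ i.
  rewrite (_ : -1 * x * (a^-1 * b) * a = a^-1 * a * (- (x * b))); last by ring.
  by rewrite mulVf ?mul1r// pnatr_eq0.
rewrite -pE; elim: N y => [|N IH] y y0.
  by rewrite expr0 mul1r /p horner_poly big_ord0 subr0 expR_ge0.
pose f (u : R) : R := (-1) ^+ N.+1 * (expR (- u) - (p N.+1).[u]).
have f0 : f 0 = 0.
  rewrite /f pE oppr0 expR0 big_ord_recl expr0 divr1 big1 ?addr0 ?subrr ?mulr0//.
  by move=> i _; rewrite expr0n/= mul0r.
have df (u : R) : is_derive u (1 : R) (f : R -> R) ((-1) ^+ N * (expR (- u) - (p N).[u])).
  have -> : (-1) ^+ N * (expR (- u) - (p N).[u]) =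
      (-1) ^+ N.+1 * (- expR (- u) - (p N.+1)^`().[u]).
    by rewrite dp hornerN exprS; ring.
  have de : is_derive u (1 : R) (fun v => expR (- v)) (- expR (- u)).
    by apply: is_derive_eq; rewrite mulrN1.
  have dh : is_derive u (1 : R) (horner (p N.+1)) (p N.+1)^`().[u] by exact: is_derive_poly.
  exact: (@is_deriveZ _ _ _ (fun v : R => expR (- v) - (p N.+1).[v]) _ _ _ _ (is_deriveB de dh)).
rewrite -/(f y) -f0.
apply: (ger0_derive1_ndecry (a := 0)) => //.
- move=> x; rewrite in_itv/= andbT => x0; rewrite derive1E.
  by have [_ ->] := df x; apply: IH; exact: ltW.
- apply: continuous_subspaceT => x.
  by have [/derivable1_diffP/differentiable_continuous h _] := df x; exact: h.
Qed.

Lemma expR_eseries (x : R) : 0 <= x ->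
  ((expR x)%:E = \sum_(0 <= n <oo) (x ^+ n / n`!%:R)%:E)%E.
Proof.
move=> x0; apply/esym/cvg_lim => //.
have : series (exp_coeff x) N @[N --> \oo] --> expR x by exact: is_cvg_series_exp_coeff.
move=> h; rewrite (_ : (fun N => _) = (fun N => (series (exp_coeff x) N)%:E)).
  by apply/fine_cvgP; split; [exact: nearW|exact: h].
by apply/funext => N; rewrite sumEFin.
Qed.

Lemma integral_expR_eseries d (T : measurableType d) (P : probability T R)
    (Y : T -> R) (c : R) (m : nat -> R) : 0 <= c ->
  measurable_fun setT Y -> (forall w, 0 <= Y w) ->
  (forall n, \int[P]_w (Y w ^+ n)%:E = (m n)%:E)%E ->
  (\int[P]_w (expR (c * Y w))%:E = \sum_(0 <= n <oo) (c ^+ n / n`!%:R * m n)%:E)%E.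
Proof.
move=> c0 mY Y0 mE.
transitivity (\int[P]_w (\sum_(0 <= n <oo) ((c ^+ n / n`!%:R)%:E * (Y w ^+ n)%:E)))%E.
  apply: eq_integral => w _; rewrite expR_eseries ?mulr_ge0//.
  by apply: eq_eseriesr => n _; rewrite -EFinM; congr EFin; rewrite exprMn; ring.
rewrite integral_nneseries//.
- apply: eq_eseriesr => n _; rewrite ge0_integralZl_EFin ?mE//.
  + by move=> w _; rewrite lee_fin exprn_ge0.
  + by apply/measurable_EFinP; exact: measurable_funX.
  + by rewrite mulr_ge0 ?exprn_ge0// invr_ge0.
- move=> n; apply: measurable_funeM; apply/measurable_EFinP; exact: measurable_funX.
- by move=> n w _; rewrite -EFinM lee_fin !mulr_ge0 ?exprn_ge0 ?invr_ge0.
Qed.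

End exponential_series.

(** * The second time change *)

Section tcgfsp.
Context {R : realType} d (T : measurableType d) (P : probability T R).
Variables (k : nat) (lam mu : 'I_k -> R) (alpha : R) (X : R -> T -> R) (U : T -> R).
Hypothesis alpha01 : 0 < alpha <= 1.
Hypothesis gX : gfsp P alpha lam mu X.
Hypothesis mU : measurable_fun setT U.
Hypothesis U0 : forall w, 0 <= U w.
Hypothesis XU : forall q, 0 <= q -> indep_rv P (X q) U.

Let alpha0 : 0 < alpha. Proof. by case/andP: alpha01. Qed.
Let mX q : 0 <= q -> measurable_fun setT (X q).
Proof. exact: (gfsp_measurable gX). Qed.
Let cX w q : 0 <= q -> X s w @[s --> q^'+] --> X q w.
Proof. exact: (gfsp_right_continuous gX). Qed.

Local Notation psi u := (skellam_exponent lam mu u).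
Local Notation ML n q := (q `^ (n%:R * alpha) / Gamma (n%:R * alpha + 1)).

Let K u q := (\int[P]_w (expR (u * X q w))%:E)%E.

Let mgf_time_change u : measurable_fun setT (fun w => K u (U w)) /\
  (\int[P]_w (expR (u * X (U w) w))%:E = \int[P]_w K u (U w))%E.
Proof.
have cphi : continuous (fun x : R => expR (u * x)).
  move=> x; apply: continuous_comp; last exact: continuous_expR.
  by apply: cvgM; [exact: cvg_cst|exact: cvg_id].
exact: (ge0_integral_time_change mX cX mU U0 XU cphi (fun x => expR_ge0 (u * x))).
Qed.

(** All terms are nonnegative, so monotone convergence exchanges sum and integral for the inner time
    and again for [U]; the identity lives in [[0, +oo]]. *)
Lemma tcgfsp_mgf_ge0 u : 0 <= psi u ->
  (\int[P]_w (expR (u * X (U w) w))%:E =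
   \sum_(0 <= n <oo) (((psi u) ^+ n / Gamma (n%:R * alpha + 1))%:E *
      \int[P]_w (U w `^ (n%:R * alpha))%:E))%E.
Proof.
move=> psi0; have [_ ->] := mgf_time_change u.
have G0 n : 0 <= (psi u) ^+ n / Gamma (n%:R * alpha + 1).
  by rewrite divr_ge0 ?exprn_ge0// ltW// Gamma_gt0// mulr_ge0// ltW.
transitivity (\int[P]_w (\sum_(0 <= n <oo)
    ((((psi u) ^+ n / Gamma (n%:R * alpha + 1))%:E * (U w `^ (n%:R * alpha))%:E))))%E.
  apply: eq_integral => w _; have [Y [mY Y0 mom mgf _]] := gfsp_marginal alpha01 gX (U0 w).
  rewrite /K mgf (integral_expR_eseries psi0 mY Y0 mom).
  apply: eq_eseriesr => n _; rewrite -EFinM; congr EFin.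
  have f0 : n`!%:R != 0 :> R by rewrite pnatr_eq0 -lt0n fact_gt0.
  by rewrite mulrA divfK//; ring.
have mUp n : measurable_fun setT (fun w => (U w `^ (n%:R * alpha))%:E).
  apply/measurable_EFinP.
  exact: (measurableT_comp (measurable_powR _) mU).
rewrite integral_nneseries//.
- apply: eq_eseriesr => n _; rewrite ge0_integralZl_EFin//.
  by move=> w _; rewrite lee_fin powR_ge0.
- by move=> n; apply: measurable_funeM.
- by move=> n w _; rewrite -EFinM lee_fin mulr_ge0 ?powR_ge0.
Qed.

Hypothesis momU : forall b, 0 < b -> (\int[P]_w (U w `^ b)%:E < +oo)%E.

Let iU n : P.-integrable setT (fun w => (U w `^ (n%:R * alpha))%:E).
Proof.
apply/integrableP; split.
  apply/measurable_EFinP; exact: (measurableT_comp (measurable_powR _) mU).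
under eq_integral do rewrite gee0_abs ?lee_fin ?powR_ge0//.
(* [momU] covers positive exponents; exponent [0] gives the constant [1], also where [U]
   vanishes. *)
case: n => [|n]; last by apply: momU; rewrite mulr_gt0.
under eq_integral do rewrite mul0r powRr0.
by rewrite integral_prob_cst ltry.
Qed.

Let eU n := fine (\int[P]_w (U w `^ (n%:R * alpha))%:E)%E.

Let eUE n : (\int[P]_w (U w `^ (n%:R * alpha))%:E = (eU n)%:E)%E.
Proof. by rewrite /eU fineK//; apply: integrable_fin_num => //; exact: iU. Qed.

(** Partial sums of the Mittag-Leffler series of index [alpha] at [psi u] times [q^alpha]. *)
Let partial_ML u N q :=
  \sum_(0 <= n < N) q `^ (n%:R * alpha) * ((psi u) ^+ n / Gamma (n%:R * alpha + 1)).

(* Alternating Taylor bounds for the exponential, integrated against the law of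
   the inner random time. *)
Let mgf_alternating u q N : psi u <= 0 -> 0 <= q ->
  [/\ (0 <= K u q)%E, (K u q <= 1)%E, ~~ odd N -> ((partial_ML u N q)%:E <= K u q)%E
    & odd N -> (K u q <= (partial_ML u N q)%:E)%E].
Proof.
move=> psi0 q0; have [Y [mY Y0 mom mgf _]] := gfsp_marginal alpha01 gX q0.
have iY m : P.-integrable setT (fun w => (Y w ^+ m)%:E).
  apply/integrableP; split; first by apply/measurable_EFinP; exact: measurable_funX.
  under eq_integral do rewrite gee0_abs ?lee_fin ?exprn_ge0//.
  by rewrite mom ltry.
have [H HE] := integral_lincomb (index_iota 0 N) (fun m => (psi u) ^+ m / m`!%:R) iY mom.
have E : \sum_(i <- index_iota 0 N) i`!%:R * ML i q * ((psi u) ^+ i / i`!%:R) = partial_ML u N q.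
  apply: eq_bigr => i _.
  have f0 : i`!%:R != 0 :> R by rewrite pnatr_eq0 -lt0n fact_gt0.
  rewrite [RHS](_ : _ = i`!%:R / i`!%:R * (q `^ (i%:R * alpha) *
    (psi u ^+ i / Gamma (i%:R * alpha + 1)))); first by ring.
  by rewrite divff// mul1r.
rewrite E in HE.
have mE : measurable_fun setT (fun w => expR (psi u * Y w)).
  by apply: measurableT_comp => //; exact: measurable_funM.
have E1 w : expR (psi u * Y w) <= 1 by rewrite expR_le1 mulr_le0_ge0.
have iE : P.-integrable setT (fun w => (expR (psi u * Y w))%:E).
  have i1 : P.-integrable setT (fun _ : T => 1%:E) by exact: finite_measure_integrable_cst.
  apply: (le_integrable measurableT _ _ i1); first exact/measurable_EFinP.
  by move=> w _; rewrite !gee0_abs ?lee_fin ?expR_ge0.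
have sand w : 0 <= (-1) ^+ N * (expR (psi u * Y w) -
    \sum_(i <- index_iota 0 N) Y w ^+ i * ((psi u) ^+ i / i`!%:R)).
  have y0 : 0 <= - psi u * Y w by rewrite mulr_ge0// oppr_ge0.
  have := expR_alternating_bound N y0; rewrite mulNr opprK.
  congr (0 <= _ * (_ - _)); rewrite big_mkord; apply: eq_bigr => i _.
  by rewrite exprMn; ring.
rewrite /K mgf; split.
- by apply: integral_ge0 => w _; rewrite lee_fin expR_ge0.
- rewrite -(integral_prob_cst P 1); apply: ge0_le_integral => //.
    exact/measurable_EFinP.
  by move=> w _; rewrite lee_fin.
- move=> oN; rewrite -HE; apply: le_integral => // w _.
  rewrite lee_fin; have := sand w.
  by rewrite -signr_odd (negbTE oN) expr0 mul1r subr_ge0.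
- move=> oN; rewrite -HE; apply: le_integral => // w _.
  rewrite lee_fin; have := sand w.
  by rewrite -signr_odd oN expr1 mulN1r opprB subr_ge0.
Qed.

(** Even partial sums lie below [K] and odd ones above, pointwise in [U], and this survives
    integration. Both subsequences of the integrated sums tend to [l]. Integrability of [K] along
    [U] follows from [0 <= K <= 1]. *)
Lemma tcgfsp_mgf_le0 u (l : R) : psi u <= 0 ->
  (\sum_(0 <= n < N) (((psi u) ^+ n / Gamma (n%:R * alpha + 1))%:E *
      \int[P]_w (U w `^ (n%:R * alpha))%:E) @[N --> \oo] --> l%:E)%E ->
  (\int[P]_w (expR (u * X (U w) w))%:E = l%:E)%E.
Proof.
move=> psi0 cvl; have [mK ->] := mgf_time_change u.
pose s N := \sum_(0 <= n < N) eU n * ((psi u) ^+ n / Gamma (n%:R * alpha + 1)).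
have sE N : (\sum_(0 <= n < N) (((psi u) ^+ n / Gamma (n%:R * alpha + 1))%:E *
      \int[P]_w (U w `^ (n%:R * alpha))%:E) = (s N)%:E)%E.
  rewrite /s -sumEFin; apply: eq_bigr => n _.
  by rewrite eUE -EFinM mulrC.
have cs : (s N)%:E @[N --> \oo] --> l%:E.
  by apply: cvg_trans cvl; apply: near_eq_cvg; apply: nearW => N.
have iS N := integral_lincomb (index_iota 0 N)
  (fun n => (psi u) ^+ n / Gamma (n%:R * alpha + 1)) iU eUE.
have alt w N := mgf_alternating N psi0 (U0 w).
have iK : P.-integrable setT (fun w => K u (U w)).
  have i1 : P.-integrable setT (fun _ : T => 1%:E) by exact: finite_measure_integrable_cst.
  apply: (le_integrable measurableT _ _ i1) => // w _.
  by have [a b _ _] := alt w 0%N; rewrite !gee0_abs.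
have lo N : ((s N.*2)%:E <= \int[P]_w K u (U w))%E.
  have [i1 e1] := iS N.*2; rewrite -e1; apply: le_integral => // w _.
  by have [_ _ h _] := alt w N.*2; apply: h; rewrite odd_double.
have hi N : (\int[P]_w K u (U w) <= (s N.*2.+1)%:E)%E.
  have [i1 e1] := iS N.*2.+1; rewrite -e1; apply: le_integral => // w _.
  by have [_ _ _ h] := alt w N.*2.+1; apply: h; rewrite /= odd_double.
have dbl : (fun N => N.*2) @ \oo --> \oo.
  move=> A [m _ Am]; exists m => // n /= mn; apply: Am => /=.
  by rewrite (leq_trans mn)// -addnn leq_addr.
have dblS : (fun N => N.*2.+1) @ \oo --> \oo.
  move=> A [m _ Am]; exists m => // n /= mn; apply: Am => /=.
  by rewrite (leq_trans mn)// -addnn -addnS leq_addr.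
apply/eqP; rewrite eq_le; apply/andP; split.
  have c := cvg_comp _ _ dblS cs.
  by apply: (cvge_to_ge c); apply: nearW => N; exact: hi.
have c := cvg_comp _ _ dbl cs.
by apply: (cvge_to_le c); apply: nearW => N; exact: lo.
Qed.

(** The fractional moments of [gfsp_moment] are finite combinations of powers of [q] with exponents
    [m * alpha], each integrable along [U]; this is what the second use of [moments_time_change]
    requires. *)
Lemma tcgfsp_moment r : (0 < r)%N ->
  (\int[P]_w (X (U w) w ^+ r)%:E = (r`!%:R)%:E *
   \sum_(1 <= n < r.+1) (\int[P]_w (U w `^ (n%:R * alpha))%:E *
     ((Gamma (n%:R * alpha + 1))^-1 * composition_sum (jump_coef lam mu) r n)%:E))%E.
Proof.
move=> r0.
have lin n := integral_lincomb (index_iota 1 n.+1)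
  (fun m => (Gamma (m%:R * alpha + 1))^-1 * composition_sum (jump_coef lam mu) n m) iU eUE.
rewrite (moments_time_change mX cX mU U0 XU (g := fun n q =>
  n`!%:R * \sum_(1 <= m < n.+1) q `^ (m%:R * alpha) *
      ((Gamma (m%:R * alpha + 1))^-1 * composition_sum (jump_coef lam mu) n m)))//.
- have [i1 e1] := lin r.
  under eq_integral do rewrite EFinM.
  rewrite integralZl// e1; congr (_ * _)%E.
  by rewrite -sumEFin; apply: eq_bigr => m _; rewrite eUE.
- by move=> n q n0 q0; exact: (gfsp_moment alpha01 gX).
- move=> n n0; have [i1 _] := lin n.
  apply: (eq_integrable measurableT _ _ _ (integrableZl measurableT (n`!%:R) i1)).
  by move=> w _; rewrite -EFinM.
Qed.

End tcgfsp.

Unset Implicit Arguments.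

Theorem mainTheorem17 (R : realType) (d : measure_display)
    (Omega : measurableType d) (P : probability Omega R)
    (k : nat) (hk : (1 <= k)%N) (lam mu : 'I_k -> R)
    (hlam : forall i, 0 < lam i) (hmu : forall i, 0 < mu i)
    (alpha : R) (halpha : 0 < alpha <= 1)
    (Sa : R -> Omega -> R) (hSa : gfsp P alpha lam mu Sa)
    (f : R -> R) (D : R -> Omega -> R) (hD : levy_subordinator P f D)
    (hind : independent_processes P Sa D)
    (hmom : forall r t : R, 0 < r -> 0 <= t ->
       ('E_P[fun w => ((D t w) `^ r)%R] < +oo)%E)
    (Z : R -> Omega -> R) (hZ : forall (t : R) (w : Omega), 0 <= t -> Z t w = Sa (D t w) w) :
  (forall t u : R, 0 <= t ->
     let term := fun n : nat =>
       (((skellam_exponent lam mu u) ^+ n / Gamma (n%:R * alpha + 1))%R%:E *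
        'E_P[fun w => ((D t w) `^ (n%:R * alpha))%R])%E in
     (* If the base is negative, the signed series may diverge although the
        left-hand side is finite. *)
     0 <= skellam_exponent lam mu u \/
       (exists l : R, (\sum_(0 <= n < N) term n)%E @[N --> \oo] --> l%:E) ->
     'M_P (Z t) u = (\sum_(0 <= n <oo) term n)%E) /\
  (forall (r : nat) (t : R), (1 <= r)%N -> 0 <= t ->
     ('E_P[fun w => ((Z t w) ^+ r)%R] =
      (r`!%:R)%:E *
      \sum_(1 <= n < r.+1)
        ('E_P[fun w => ((D t w) `^ (n%:R * alpha))%R] *
         ((Gamma (n%:R * alpha + 1))^-1 *
          \sum_(m : {ffun 'I_n -> 'I_r.+1} |
                 ((\sum_(l < n) m l)%N == r) && [forall l, (0 < m l)%N])
            \prod_(l < n)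
              (((m l)`!%:R)^-1 *
               \sum_(i < k) (i.+1%:R ^+ (m l) * lam i +
                             (-1) ^+ (m l) * i.+1%:R ^+ (m l) * mu i))%R)%:E))%E).
Proof.
have indq t q : 0 <= t -> 0 <= q -> indep_rv P (Sa q) (D t).
  by move=> t0 q0 B C mB mC; apply: hind; exact: process_sigma_preimage.
have mD t : 0 <= t -> measurable_fun setT (D t) by exact: (subordinator_measurable hD).
have D0 t w : 0 <= t -> 0 <= D t w by case: hD => _ h _ _ _; exact: h.
have EE (V : Omega -> R) : 'E_P[V]%E = (\int[P]_w (V w)%:E)%E by rewrite unlock.
have mom t b : 0 <= t -> 0 < b -> (\int[P]_w (D t w `^ b)%:E < +oo)%E.
  by move=> t0 b0; rewrite -EE; exact: hmom.
split=> [t u t0 term H|r t r0 t0].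
- have ZE : 'M_P (Z t) u = (\int[P]_w (expR (u * Sa (D t w) w))%:E)%E.
    rewrite /mmt_gen_fun EE; apply: eq_integral => w _ /=.
    by rewrite hZ// mulrC.
  have termE : term = (fun n => ((skellam_exponent lam mu u) ^+ n /
      Gamma (n%:R * alpha + 1))%:E * \int[P]_w (D t w `^ (n%:R * alpha))%:E)%E.
    by apply/funext => n; rewrite /term EE.
  rewrite ZE termE; rewrite termE in H.
  have [psi0|psi0] := leP 0 (skellam_exponent lam mu u).
    exact: (tcgfsp_mgf_ge0 halpha hSa (mD t t0) (fun w => D0 t w t0) (fun q => indq t q t0)).
  (* With a negative exponent the first alternative is impossible, so the limit [l] of the partial
     sums is at hand. *)
  case: H => [|[l cvl]]; first by rewrite leNgt psi0.
  rewrite (tcgfsp_mgf_le0 halpha hSa (mD t t0) (fun w => D0 t w t0) (fun q => indq t q t0)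
    (fun b => mom t b t0) (ltW psi0) cvl).
  by apply/esym/cvg_lim.
- rewrite EE.
  transitivity (\int[P]_w (Sa (D t w) w ^+ r)%:E)%E.
    by apply: eq_integral => w _; rewrite hZ.
  rewrite (tcgfsp_moment halpha hSa (mD t t0) (fun w => D0 t w t0) (fun q => indq t q t0)
    (fun b => mom t b t0) r0).
  (* The explicit inner sum of the statement is [composition_sum (jump_coef lam mu) r n] up to
     unfolding. *)
  by congr (_ * _)%E; apply: eq_bigr => n _; rewrite EE.
Qed.
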